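(* For $j=1,2$, let $(S_j,f_j)$ be a normed set, let $R_j$ be a set of C*-relations on $(S_j,f_j)$, and let $\mathcal{A}_j:=\langle S_j,f_j\mid R_j\rangle_{\mathbf{1C}^*}$ be the unital C*-algebra presented on $(S_j,f_j)$ subject to $R_j$. Then $\mathcal{A}_1$ and $\mathcal{A}_2$ are isomorphic as unital C*-algebras (i.e. there is a unital $*$-isomorphism $\mathcal{A}_1\to\mathcal{A}_2$) if and only if there is a sequence of four Tietze transformations changing the presentation $\langle S_1,f_1\mid R_1\rangle_{\mathbf{1C}^*}$ of $\mathcal{A}_1$ into the presentation $\langle S_2,f_2\mid R_2\rangle_{\mathbf{1C}^*}$ of $\mathcal{A}_2$.
   Context: A normed set $(S,f)$ is a set $S$ with a function $f:S\to[0,\infty)$. A map $\phi:(S,f)\to(T,g)$ of normed sets is contractive if $g(\phi(s))\le f(s)$ for all $s\in S$. A C*-algebra is regarded as a normed set via its norm. The disjoint union (coproduct) of normed sets is the disjoint union of the underlying sets with the function restricting to the given function on each summand. Unital C*-algebras include the zero algebra. The scaled-free unital C*-algebra $\mathrm{1C^*Alg}(S,f)$ is the unital C*-algebra with a contractive map $\eta_{S,f}:S\to \mathrm{1C^*Alg}(S,f)$ such that for every unital C*-algebra $\mathcal{B}$ and every contractive map $\phi:(S,f)\to\mathcal{B}$ there is a unique unital $*$-homomorphism $\hat\phi:\mathrm{1C^*Alg}(S,f)\to\mathcal{B}$ with $\hat\phi\circ\eta_{S,f}=\phi$. (It is the unitization of the analogous scaled-free C*-algebra on $(S,f)$.) One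 writes $s$ for $\eta_{S,f}(s)$ and for its classes in quotients. A C*-relation on $(S,f)$ is any element $r\in\mathrm{1C^*Alg}(S,f)$. For a set $R\subseteq\mathrm{1C^*Alg}(S,f)$, let $J_R$ be the norm-closed two-sided ideal generated by $R$; the unital C*-algebra presented on $(S,f)$ subject to $R$ is $\langle S,f\mid R\rangle_{\mathbf{1C}^*}:=\mathrm{1C^*Alg}(S,f)/J_R$. Tietze transformations of a presentation $\langle S,f\mid R\rangle_{\mathbf{1C}^*}$, with $\mathcal{F}:=\mathrm{1C^*Alg}(S,f)=\langle S,f\mid\emptyset\rangle_{\mathbf{1C}^*}$, are of two kinds: (1) Addition or removal of redundant C*-relations. A set $Q\subseteq\mathcal{F}$ of C*-relations is redundant for $R$ if $Q\subseteq J_R$. The transformation replaces $\langle S,f\mid R\rangle_{\mathbf{1C}^*}$ by $\langle S,f\mid R\cup Q\rangle_{\mathbf{1C}^*}$, or conversely. (2) Addition or removal of redundant generators. Let $G\subseteq\mathcal{F}$ be a subset, and associate to each $g\in G$ a new symbol $s_g$ and a value $\lambda_g\in[\|g\|_{\mathcal{F}},\infty)$. Let $S_G:=\{s_g:g\in G\}$ and $f_G(s_g):=\lambda_g$. Let $(S',f')$ be the disjoint union of the normed sets $(S,f)$ and $(S_G,f_G)$, let $\rho:(S,f)\to(S',f')$ be the canonical inclusion, and let $\hat\rho:\mathcal{F}\to\mathrm{1C^*Alg}(S',f')$ be the unital $*$-homomorphism induced by $\rho$, which embeds $\mathcal{F}$ by association of generators. Let $R':=\hat\rho(R)\cup\{s_g-\hat\rho(g):g\in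 G\}$. The transformation replaces $\langle S,f\mid R\rangle_{\mathbf{1C}^*}$ by $\langle S',f'\mid R'\rangle_{\mathbf{1C}^*}$, or conversely.
   Formalization: In transformation (2), G is an indexed family of elements, so several new symbols may name one element; with one symbol per element of a subset G the claim fails: no generators (algebra C) versus five generators with f = 0 and no relations cannot be linked in four steps. *)

(* Defs.v *)
From HB Require Import structures.
From mathcomp Require Import all_boot all_order all_algebra.
From mathcomp Require Import complex.
From mathcomp Require Import all_classical reals topology normedtype sequences.
From mathcomp Require Import ring lra.

Set Implicit Arguments.
Unset Strict Implicit.
Unset Printing Implicit Defensive.

Import Order.TTheory GRing.Theory Num.Theory.
Import numFieldNormedType.Exports.

Local Open Scope classical_set_scope.
Local Open Scope complex_scope.
Local Open Scope ring_scope.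
Local Open Scope quotient_scope.

(* A unital C*-algebra over R[i], possibly zero.  MathComp's algType and its
   hierarchy require 1 != 0, so the multiplicative structure is spelled out on
   top of completeNormedModType; the ring notations are recovered below. *)
Record unitalCstar (R : realType) := UnitalCstar {
  cstar_base : completeNormedModType R[i];
  cstar_mul : cstar_base -> cstar_base -> cstar_base;
  cstar_one : cstar_base;
  cstar_star : cstar_base -> cstar_base;
  cstar_mulA : associative cstar_mul;
  cstar_mul1l : left_id cstar_one cstar_mul;
  cstar_mul1r : right_id cstar_one cstar_mul;
  cstar_mulDl : left_distributive cstar_mul +%R;
  cstar_mulDr : right_distributive cstar_mul +%R;
  cstar_scaleAl : forall (k : R[i]) x y,
    k *: cstar_mul x y = cstar_mul (k *: x) y;
  cstar_scaleAr : forall (k : R[i]) x y,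
    k *: cstar_mul x y = cstar_mul x (k *: y);
  cstar_starK : involutive cstar_star;
  cstar_starD : {morph cstar_star : x y / x + y};
  cstar_starZ : forall (k : R[i]) x,
    cstar_star (k *: x) = conjc k *: cstar_star x;
  cstar_starM : forall x y,
    cstar_star (cstar_mul x y) = cstar_mul (cstar_star y) (cstar_star x);
  cstar_normM : forall x y, `|cstar_mul x y| <= `|x| * `|y|;
  cstar_norm_starM : forall x, `|cstar_mul (cstar_star x) x| = `|x| ^+ 2 }.

Definition cstar_sort (R : realType) (A : unitalCstar R) : Type := cstar_base A.
Coercion cstar_sort : unitalCstar >-> Sortclass.

HB.instance Definition _ (R : realType) (A : unitalCstar R) :=
  CompleteNormedModule.copy (cstar_sort A) (cstar_base A).

HB.instance Definition _ (R : realType) (A : unitalCstar R) :=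
  GRing.Zmodule_isPzRing.Build (cstar_sort A) (@cstar_mulA R A)
    (@cstar_mul1l R A) (@cstar_mul1r R A) (@cstar_mulDl R A) (@cstar_mulDr R A).

Definition star (R : realType) (A : unitalCstar R) : A -> A := @cstar_star R A.

Section Basics.
Variables (R : realType) (A : unitalCstar R).
Implicit Types x y : A.

Lemma cscalerAl (k : R[i]) x y : k *: (x * y) = (k *: x) * y.
Proof. exact: cstar_scaleAl. Qed.

Lemma cscalerAr (k : R[i]) x y : k *: (x * y) = x * (k *: y).
Proof. exact: cstar_scaleAr. Qed.

Lemma starK : involutive (@star R A).
Proof. exact: cstar_starK. Qed.

Lemma starD x y : star (x + y) = star x + star y.
Proof. exact: cstar_starD. Qed.

Lemma starZ (k : R[i]) x : star (k *: x) = conjc k *: star x.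
Proof. exact: cstar_starZ. Qed.

Lemma starM x y : star (x * y) = star y * star x.
Proof. exact: cstar_starM. Qed.

Lemma star0 : star (0 : A) = 0.
Proof. by rewrite -{1}(scale0r (0 : A)) starZ conjc0 scale0r. Qed.

Lemma starN x : star (- x) = - star x.
Proof. by apply/eqP; rewrite -addr_eq0 -starD addNr star0. Qed.

Lemma starB x y : star (x - y) = star x - star y.
Proof. by rewrite starD starN. Qed.

Lemma star1 : star (1 : A) = 1.
Proof. by rewrite -[LHS]mulr1 -{2}[1]starK -starM mulr1 starK. Qed.

(* The norm takes its values in R[i]; rnorm is the same norm, valued in R. *)
Definition rnorm x : R := complex.Re `|x|.

Lemma rnormE x : `|x| = (rnorm x)%:C.
Proof.
rewrite /rnorm; have : 0 <= `|x| by exact: normr_ge0.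
by case: (`|x|) => a b; rewrite lecE /= => /andP[/eqP -> _].
Qed.

Lemma rnorm_ge0 x : 0 <= rnorm x.
Proof. by rewrite -lecR -rnormE; exact: normr_ge0. Qed.

Lemma rnorm0 : rnorm 0 = 0.
Proof. by rewrite /rnorm normr0. Qed.

Lemma rnormN x : rnorm (- x) = rnorm x.
Proof. by rewrite /rnorm normrN. Qed.

Lemma rnormBC x y : rnorm (x - y) = rnorm (y - x).
Proof. by rewrite -rnormN opprB. Qed.

Lemma rnormD x y : rnorm (x + y) <= rnorm x + rnorm y.
Proof. by rewrite -lecR rmorphD /= -!rnormE ler_normD. Qed.

Lemma rnorm_tri x y z : rnorm (x - z) <= rnorm (x - y) + rnorm (y - z).
Proof. by rewrite -(subrKA y x (- z)) rnormD. Qed.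

Lemma rnormM x y : rnorm (x * y) <= rnorm x * rnorm y.
Proof. by rewrite -lecR rmorphM /= -!rnormE; exact: cstar_normM. Qed.

Lemma rnormZ (k : R[i]) x : rnorm (k *: x) = complex.Re `|k| * rnorm x.
Proof. by rewrite {1}/rnorm normrZ rnormE normc_def -rmorphM. Qed.

Lemma rnormZr (k : R) x : rnorm (k%:C *: x) = `|k| * rnorm x.
Proof. by rewrite rnormZ normc_def /= expr0n addr0 sqrtr_sqr. Qed.

Lemma rnorm_starM x : rnorm (star x * x) = rnorm x ^+ 2.
Proof.
rewrite {1}/rnorm; have -> : `|star x * x| = `|x| ^+ 2 :> R[i].
  exact: cstar_norm_starM.
by rewrite rnormE -rmorphXn.
Qed.

Lemma rnorm0_eq0 x : rnorm x = 0 -> x = 0.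
Proof. by move=> h; apply/eqP; rewrite -normr_eq0 rnormE h. Qed.

Lemma rnorm_star_le x : rnorm x <= rnorm (star x).
Proof.
have [x0|x0] := eqVneq (rnorm x) 0; first by rewrite x0 rnorm_ge0.
have xp : 0 < rnorm x by rewrite lt_def x0 rnorm_ge0.
by rewrite -(ler_pM2r xp) -expr2 -rnorm_starM rnormM.
Qed.

Lemma rnorm_star x : rnorm (star x) = rnorm x.
Proof.
apply/eqP; rewrite eq_le rnorm_star_le andbT.
by have := rnorm_star_le (star x); rewrite starK.
Qed.

Lemma rnorm1_le : rnorm 1 <= 1.
Proof.
have := rnorm_starM 1; rewrite star1 mulr1 expr2 => h.
have [->//|n0] := eqVneq (rnorm 1) 0.
by move: h; rewrite -{1}[rnorm 1]mulr1 => /(mulfI n0) <-.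
Qed.

Lemma rnormX x n : rnorm (x ^+ n) <= rnorm x ^+ n.
Proof.
elim: n => [|n ih]; first by rewrite !expr0 rnorm1_le.
rewrite !exprS (le_trans (rnormM _ _))// ler_wpM2l// rnorm_ge0//.
Qed.

Lemma ballP x y (e : R[i]) : 0 < e ->
  ball x e y <-> rnorm (x - y) < complex.Re e.
Proof.
case: e => a b; rewrite ltcE /= => /andP[/eqP b0 a0].
by rewrite -ball_normE /ball_ /= rnormE ltcE /= b0 eqxx.
Qed.

Lemma closed_rnorm (J : set A) x : closed J ->
  (forall e : R, 0 < e -> exists2 z, J z & rnorm (x - z) < e) -> J x.
Proof.
move=> clJ h; apply: clJ => B /nbhs_ballP[e /= e0 xB].
have re0 : 0 < complex.Re e by move: e0; rewrite ltcE => /andP[].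
have [z Jz zx] := h _ re0; exists z; split => //; apply: xB.
exact/ballP.
Qed.

Lemma complete_rnorm (u : nat -> A) :
  (forall e : R, 0 < e -> exists N, forall m n, (N <= m)%N -> (N <= n)%N ->
     rnorm (u m - u n) < e) ->
  exists l, forall e : R, 0 < e -> exists N, forall n, (N <= n)%N ->
     rnorm (l - u n) < e.
Proof.
move=> h.
have cu : cauchy (u @ \oo).
  apply: cauchy_exP => e e0.
  have re0 : 0 < complex.Re e by move: e0; rewrite ltcE => /andP[].
  have [N hN] := h _ re0; exists (u N), N => // n /= Nn.
  by apply/ballP => //; exact: hN.
have /cvg_ex[l ul] : cvg (u @ \oo) by exact: cauchy_cvg.
exists l => e e0.
have e0' : 0 < e%:C by rewrite ltcR.
have [N _ hN] := (cvg_ball ul e0'); exists N => n Nn.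
by have /(ballP _ _ e0') := hN _ Nn.
Qed.

End Basics.

Section FunctionalCalculus.
Variables (R : realType) (A : unitalCstar R).
Implicit Types (x y h : A) (t : R).

Lemma small_le0 (a K : R) : 0 <= K -> (forall e, 0 < e -> a <= K * e) -> a <= 0.
Proof.
move=> K0 h; rewrite leNgt; apply/negP => a0.
have K1 : 0 < K + 1 by rewrite ltr_wpDl.
have := h _ (divr_gt0 a0 K1); rewrite leNgt => /negP; apply.
by rewrite mulrCA gtr_pMr// ltr_pdivrMr// mul1r ltrDl.
Qed.

Lemma expr_small (r e : R) : 0 <= r < 1 -> 0 < e ->
  exists N, forall n, (N <= n)%N -> r ^+ n < e.
Proof.
move=> /andP[r0 r1] e0.
have r1' : `|r| < 1 by rewrite ger0_norm.
have [N _ hN] := (@cvgr_distC_lt _ _ _ _ _ _ _ (cvg_expr r1') _ e0).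
exists N => n Nn; have := hN n Nn; rewrite /= subr0 ger0_norm//.
exact: exprn_ge0.
Qed.

Lemma geometric_cvg (u : nat -> A) (c r : R) : 0 <= r < 1 -> 0 <= c ->
  (forall n, rnorm (u n.+1 - u n) <= c * r ^+ n) ->
  exists l, forall e : R, 0 < e -> exists N, forall n, (N <= n)%N ->
     rnorm (l - u n) < e.
Proof.
move=> /andP[r0 r1] c0 hu; have r1' : 0 < 1 - r by rewrite subr_gt0.
have step n k : rnorm (u (n + k)%N - u n) <= c * r ^+ n * (1 - r ^+ k) / (1 - r).
  elim: k => [|k ih].
    by rewrite addn0 subrr rnorm0 expr0 subrr mulr0 mul0r.
  rewrite addnS; apply: (le_trans (rnorm_tri _ (u (n + k)%N) _)).
  apply: (le_trans (lerD (hu _) ih)).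
  rewrite ler_pdivlMr// mulrDl divfK ?gt_eqF// exprD exprS.
  by rewrite le_eqVlt; apply/orP; left; apply/eqP; ring.
have tail n k : rnorm (u (n + k)%N - u n) <= c / (1 - r) * r ^+ n.
  apply: (le_trans (step n k)).
  rewrite [leRHS]mulrAC ler_wpM2r ?invr_ge0 ?(ltW r1')//.
  rewrite -[leRHS]mulr1 ler_wpM2l ?mulr_ge0 ?exprn_ge0//.
  by rewrite gerBl exprn_ge0.
apply: complete_rnorm => e e0.
have K0 : 0 < c / (1 - r) + 1.
  by rewrite ltr_wpDl// divr_ge0// ltW.
have r01 : 0 <= r < 1 by rewrite r0.
have e2 : 0 < e / 2 / (c / (1 - r) + 1) by rewrite !divr_gt0.
have [N hN] := expr_small r01 e2; exists N => m n Nm Nn.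
have half p : (N <= p)%N -> rnorm (u p - u N) < e / 2.
  move=> Np; rewrite -(subnKC Np); apply: (le_lt_trans (tail _ _)).
  have := hN N (leqnn _); rewrite ltr_pdivlMr// mulrC; apply: le_lt_trans.
  by rewrite ler_wpM2r ?exprn_ge0// lerDl.
apply: (le_lt_trans (rnorm_tri _ (u N) _)).
rewrite [X in _ + X]rnormBC [e]splitr.
by apply: ltrD; exact: half.
Qed.

Lemma neumann x : rnorm x < 1 -> exists y, y * (1 - x) = 1 /\ (1 - x) * y = 1.
Proof.
move=> x1; have r01 : 0 <= rnorm x < 1 by rewrite rnorm_ge0.
pose u n := \sum_(i < n) x ^+ i.
have uL n : (1 - x) * u n = 1 - x ^+ n.
  elim: n => [|n ih]; first by rewrite /u big_ord0 mulr0 expr0 subrr.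
  rewrite /u big_ord_recr /= mulrDr ih mulrBl mul1r -exprS.
  by rewrite addrA subrK.
have uC n : u n * (1 - x) = (1 - x) * u n.
  rewrite /u mulr_suml mulr_sumr; apply: eq_bigr => i _.
  by rewrite mulrBr mulrBl mulr1 mul1r -exprSr -exprS.
have [|l hl] := @geometric_cvg u 1 (rnorm x) r01 ler01.
  move=> n; rewrite mul1r.
  have -> : u n.+1 - u n = x ^+ n by rewrite /u big_ord_recr /= [LHS]addrC addKr.
  exact: rnormX.
have K0 : 0 <= rnorm (1 - x) + 1 by rewrite addr_ge0// rnorm_ge0.
have key e : 0 < e -> exists n, rnorm (l - u n) < e /\ rnorm x ^+ n < e.
  move=> e0; have [N1 h1] := hl _ e0; have [N2 h2] := expr_small r01 e0.
  by exists (maxn N1 N2); rewrite h1 ?leq_maxl// h2// leq_maxr.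
exists l; split; apply/eqP; rewrite -subr_eq0; apply/eqP/rnorm0_eq0;
  apply/eqP; rewrite eq_le rnorm_ge0 andbT; apply: (small_le0 K0) => e e0;
  have [n [/ltW ln /ltW xn]] := key _ e0.
- have -> : l * (1 - x) - 1 = (l - u n) * (1 - x) - x ^+ n.
    by rewrite [in RHS]mulrBl uC uL opprB addrA addrAC addrK.
  apply: (le_trans (rnormD _ _)); rewrite rnormN [leRHS]mulrDl [1 * e]mul1r.
  apply: lerD; last exact: le_trans (rnormX _ _) xn.
  apply: (le_trans (rnormM _ _)); rewrite mulrC.
  by rewrite ler_wpM2l// rnorm_ge0.
- have -> : (1 - x) * l - 1 = (1 - x) * (l - u n) - x ^+ n.
    by rewrite [in RHS]mulrBr uL opprB addrA addrAC addrK.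
  apply: (le_trans (rnormD _ _)); rewrite rnormN [leRHS]mulrDl [1 * e]mul1r.
  apply: lerD; last exact: le_trans (rnormX _ _) xn.
  apply: (le_trans (rnormM _ _)).
  by rewrite ler_wpM2l// rnorm_ge0.
Qed.

Lemma norm_imag : `|'i : R[i]| = 1.
Proof. by rewrite normc_def /= expr0n expr1n add0r sqrtr1. Qed.

Definition resolvent_base h (t : R) : A := t%:C *: (1 : A) - 'i *: h.
Local Notation a := resolvent_base.

Lemma star_base h t : star h = h -> star (a h t) = t%:C *: (1 : A) + 'i *: h.
Proof.
move=> sh; rewrite /a starB !starZ star1 sh.
have -> : conjc t%:C = t%:C by rewrite /= oppr0.
have -> : conjc 'i = - 'i :> R[i] by apply/eqP; rewrite eq_complex /= oppr0 !eqxx.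
by rewrite scaleNr opprK.
Qed.

Lemma comm_base h t : h * a h t = a h t * h.
Proof.
by rewrite /a mulrBl mulrBr -!cscalerAl -!cscalerAr mulr1 mul1r.
Qed.

Lemma cayley h t y : star h = h -> 0 < t -> y * a h t = 1 -> a h t * y = 1 ->
  rnorm y <= t^-1 /\ rnorm (h * y) <= 1.
Proof.
move=> sh t0 ya ay; pose b := star (a h t); pose U := b * y.
have bE : b = t%:C *: (1 : A) + 'i *: h by rewrite /b star_base.
have ab : a h t * b = b * a h t.
  rewrite bE [LHS]mulrDr [RHS]mulrDl -!cscalerAl -!cscalerAr mulr1.
  rewrite mul1r.
  by rewrite comm_base.
have syb : star y * b = 1 by rewrite -starM ay star1.
have U1 : rnorm U <= 1.
  rewrite -(@ler_pXn2r _ 2) ?nnegrE ?rnorm_ge0//.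
  rewrite -rnorm_starM /U starM /b starK -/b.
  by rewrite mulrA -(mulrA (star y)) ab mulrA syb mul1r ay expr1n rnorm1_le.
split.
  have E : U + 1 = (2 * t)%:C *: y.
    rewrite /U -ay -mulrDl bE /a addrACA subrr addr0 -scalerDl.
    by rewrite -cscalerAl mul1r -rmorphD /= mulr_natl mulr2n.
  have : (2 * t) * rnorm y <= 2.
    rewrite -[2 * t]gtr0_norm ?mulr_gt0// -rnormZr -E.
    by apply: (le_trans (rnormD _ _)); rewrite lerD// rnorm1_le.
  by rewrite -mulrA -[leRHS]mulr1 ler_pM2l// mulrC -ler_pdivlMr// div1r.
have E : U - 1 = (2 * 'i) *: (h * y).
  rewrite /U -ay -mulrBl bE /a opprB [_ + ('i *: h - _)]addrC subrKA.
  by rewrite -scalerDl -cscalerAl mulr_natl mulr2n.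
have : rnorm ((2 * 'i) *: (h * y)) <= 2.
  rewrite -E; apply: (le_trans (rnormD _ _)).
  by rewrite rnormN lerD// rnorm1_le.
rewrite rnormZ.
have -> : complex.Re `|2 * 'i : R[i]| = 2.
  by rewrite normrM normr_nat norm_imag mulr1 -(rmorph_nat (real_complex R)).
by rewrite -[leRHS]mulr1 ler_pM2l.
Qed.

Lemma base_inv h n t : star h = h -> 0 < t -> rnorm h < 2 ^+ n * t ->
  exists y, y * a h t = 1 /\ a h t * y = 1.
Proof.
move=> sh; elim: n t => [|n ih] t t0 ht.
  have tC : t%:C != 0 :> R[i] by rewrite (fmorph_eq0 (real_complex R)) gt_eqF.
  have [|y [y1 y2]] := @neumann ((t%:C^-1 * 'i) *: h).
    rewrite rnormZ normrM norm_imag mulr1 -(fmorphV (real_complex R)).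
    rewrite normc_def /= expr0n addr0 sqrtr_sqr normfV gtr0_norm//.
    by rewrite mulrC ltr_pdivrMr// mul1r; rewrite expr0 mul1r in ht.
  have E : a h t = t%:C *: (1 - (t%:C^-1 * 'i) *: h).
    by rewrite /a scalerBr scalerA mulrA divff// mul1r.
  exists (t%:C^-1 *: y); rewrite E -!cscalerAl -!cscalerAr !scalerA y1 y2.
  by rewrite mulVf// divff// scale1r.
have t2 : 0 < 2 * t by rewrite mulr_gt0.
have [|y [ya ay]] := ih (2 * t) t2; first by rewrite mulrA -exprSr.
have [ny _] := cayley sh t2 ya ay.
have [|z [z1 z2]] := @neumann (t%:C *: y).
  rewrite rnormZr gtr0_norm//; apply: (@le_lt_trans _ _ (t * (2 * t)^-1)).
    by rewrite ler_wpM2l// ltW.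
  rewrite ltr_pdivrMr// mul1r; lra.
have E1 : a h t = (1 - t%:C *: y) * a h (2 * t).
  rewrite mulrBl mul1r -cscalerAl ya /a [RHS]addrAC.
  by congr (_ + _); rewrite -scalerBl -rmorphB /=; congr (_%:C *: _); ring.
exists (y * z); split.
  by rewrite E1 -mulrA (mulrA z) z1 mul1r.
by rewrite E1 -mulrA (mulrA _ y) ay mul1r.
Qed.

(* For self-adjoint h, an element e of the unit ball which is 1 modulo h and
   almost annihilates h, namely e = t^2 (t^2 + h^2)^-1. *)
Lemma approx_unit h t : star h = h -> 0 < t ->
  exists e w, [/\ star e = e, rnorm e <= 1, 1 - e = w * h & rnorm (h * e) <= t].
Proof.
move=> sh t0.
have [n hn] : exists n, rnorm h < 2 ^+ n * t.
  have h1 : 0 < rnorm h + 1 by rewrite ltr_wpDl ?rnorm_ge0.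
  have r01 : 0 <= (2^-1 : R) < 1 by apply/andP; split; lra.
  have [n /(_ n (leqnn n)) hn] := expr_small r01 (divr_gt0 t0 h1).
  exists n; move: hn; rewrite exprVn ltr_pdivlMr// mulrC -ltr_pdivlMr ?invr_gt0 ?exprn_gt0//.
  by rewrite invrK mulrC => /(lt_trans _); apply; rewrite ltrDl.
have [y [ya ay]] := base_inv sh t0 hn.
have [ny nhy] := cayley sh t0 ya ay.
pose b := star (a h t).
have bE : b = t%:C *: (1 : A) + 'i *: h by rewrite /b star_base.
have syb : star y * b = 1 by rewrite -starM ay star1.
have bsy : b * star y = 1 by rewrite -starM ya star1.
have hb : h * b = b * h.
  by rewrite bE mulrDl mulrDr -!cscalerAl -!cscalerAr mulr1 mul1r.
have hsy : h * star y = star y * h.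
  by rewrite -[LHS]mul1r -syb -mulrA (mulrA b) -hb -(mulrA h) bsy mulr1.
have inv2 : star y * y * ((t ^+ 2)%:C *: (1 : A) + h * h) = 1.
  have -> : (t ^+ 2)%:C *: (1 : A) + h * h = a h t * b.
    rewrite bE mulrDr -!cscalerAr mulr1 /a scalerBr mulrBl -cscalerAl mul1r.
    rewrite -cscalerAl scalerBr !scalerA addrA.
    have -> : 'i * 'i = -1 :> R[i] by rewrite -expr2 sqr_i.
    rewrite scaleN1r opprK -rmorphM -expr2 [t%:C * 'i]mulrC.
    by rewrite subrK.
  by rewrite -mulrA (mulrA y) ya mul1r.
exists ((t ^+ 2)%:C *: (star y * y)), (star y * y * h); split.
- by rewrite starZ starM starK; congr (_ *: _); rewrite /= oppr0.
- rewrite rnormZr ger0_norm ?sqr_ge0// rnorm_starM -exprMn exprn_ile1//.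
    by rewrite mulr_ge0 ?rnorm_ge0// ltW.
  by rewrite -ler_pdivlMl// mulr1.
- rewrite -{1}inv2 mulrDr -cscalerAr mulr1 addrAC subrr add0r.
  by rewrite mulrA.
- rewrite -cscalerAr mulrA hsy -mulrA rnormZr ger0_norm ?sqr_ge0//.
  rewrite expr2 -mulrA -[leRHS]mulr1 ler_pM2l//.
  apply: (le_trans (ler_wpM2l (ltW t0) (rnormM _ _))).
  rewrite mulrA mulr_ile1 ?mulr_ge0 ?rnorm_ge0//; first exact: ltW.
  by rewrite rnorm_star -ler_pdivlMl// mulr1.
Qed.

End FunctionalCalculus.

(* Two-sided, norm-closed; closure under scalars follows from k *: x = k%:A * x. *)
Definition is_closed_ideal (R : realType) (A : unitalCstar R) (J : set A) :=
  [/\ J 0, (forall x y, J x -> J y -> J (x + y)),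
      (forall a x, J x -> J (a * x)), (forall a x, J x -> J (x * a))
    & closed J].

Record closed_ideal (R : realType) (A : unitalCstar R) := ClosedIdeal {
  ideal_set : set A;
  ideal_closed : is_closed_ideal ideal_set }.

Section GeneratedIdeal.
Variables (R : realType) (A : unitalCstar R) (X : set A).

Lemma is_closed_ideal_gen : is_closed_ideal (smallest (@is_closed_ideal R A) X).
Proof.
split.
- by move=> J [[J0 _ _ _ _] _].
- by move=> x y hx hy J hJ; have [[_ JD _ _ _] _] := hJ; exact: JD (hx _ hJ) (hy _ hJ).
- by move=> a x hx J hJ; have [[_ _ JM _ _] _] := hJ; exact: JM (hx _ hJ).
- by move=> a x hx J hJ; have [[_ _ _ JM _] _] := hJ; exact: JM (hx _ hJ).
- by apply: closed_bigI => J [[_ _ _ _ cJ] _].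
Qed.

Definition gen_ideal : closed_ideal A := ClosedIdeal is_closed_ideal_gen.

End GeneratedIdeal.

Section IdealTheory.
Variables (R : realType) (A : unitalCstar R) (I : closed_ideal A).
Implicit Types x y a : A.
Local Notation J := (ideal_set I).

Lemma ideal0 : J 0. Proof. by have [] := ideal_closed I. Qed.

Lemma idealD x y : J x -> J y -> J (x + y).
Proof. by have [_ JD _ _ _] := ideal_closed I; exact: JD. Qed.

Lemma idealMl a x : J x -> J (a * x).
Proof. by have [_ _ JM _ _] := ideal_closed I; exact: JM. Qed.

Lemma idealMr a x : J x -> J (x * a).
Proof. by have [_ _ _ JM _] := ideal_closed I; exact: JM. Qed.

Lemma idealZ (k : R[i]) x : J x -> J (k *: x).
Proof. by move=> Jx; rewrite -[x]mul1r cscalerAl; exact: idealMl. Qed.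

Lemma idealN x : J x -> J (- x).
Proof. by move=> Jx; rewrite -scaleN1r; exact: idealZ. Qed.

Lemma idealB x y : J x -> J y -> J (x - y).
Proof. by move=> Jx /idealN; exact: idealD. Qed.

Lemma ideal_star x : J x -> J (star x).
Proof.
move=> Jx; pose h := star x * x.
have sh : star h = h by rewrite /h starM starK.
have [_ _ _ _ clJ] := ideal_closed I.
apply: (closed_rnorm clJ) => d d0.
have t0 : 0 < (d / 2) ^+ 2 by rewrite exprn_gt0// divr_gt0.
have [e [w [se ne ew he]]] := approx_unit sh t0.
exists (star x - e * star x).
  have -> : star x - e * star x = w * h * star x by rewrite -ew mulrBl mul1r.
  by apply/idealMr/idealMl/idealMl.
rewrite opprB addrC subrK.
apply: (@le_lt_trans _ _ (d / 2)); last by lra.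
rewrite -(@ler_pXn2r _ 2) ?nnegrE ?rnorm_ge0 ?divr_ge0 ?(ltW d0)//.
rewrite -rnorm_star starM starK se -rnorm_starM starM se.
apply: le_trans he; rewrite -mulrA (mulrA (star x)) -/h.
by apply: (le_trans (rnormM _ _)); rewrite ler_piMl ?rnorm_ge0.
Qed.

Definition ideal_rel : rel A := fun x y => `[< J (x - y) >].

Lemma ideal_rel_refl : reflexive ideal_rel.
Proof. by move=> x; apply/asboolP; rewrite subrr; exact: ideal0. Qed.

Lemma ideal_rel_sym : symmetric ideal_rel.
Proof.
by move=> x y; apply/asboolP/asboolP => /idealN; rewrite opprB.
Qed.

Lemma ideal_rel_trans : transitive ideal_rel.
Proof.
move=> y x z /asboolP xy /asboolP yz; apply/asboolP.
by rewrite -(subrKA y); exact: idealD.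
Qed.

Canonical ideal_equiv :=
  EquivRel ideal_rel ideal_rel_refl ideal_rel_sym ideal_rel_trans.

Definition quot := {eq_quot ideal_equiv}.
HB.instance Definition _ := Choice.on quot.
HB.instance Definition _ := EqQuotient.on quot.

Definition quot_pi (x : A) : quot := \pi_quot x.

Lemma quot_piP x y : quot_pi x = quot_pi y <-> J (x - y).
Proof.
split=> [/eqP|xy]; first by rewrite /quot_pi eqmodE => /asboolP.
by apply/eqP; rewrite /quot_pi eqmodE; apply/asboolP.
Qed.

Lemma quot_piK (q : quot) : quot_pi (repr q) = q.
Proof. by rewrite /quot_pi reprK. Qed.

Lemma quot_surj (q : quot) : exists x, q = quot_pi x.
Proof. by exists (repr q); rewrite quot_piK. Qed.

Lemma quot_repr x : J (repr (quot_pi x) - x).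
Proof. by apply/quot_piP; rewrite quot_piK. Qed.

Definition quot_add (q r : quot) := quot_pi (repr q + repr r).
Definition quot_opp (q : quot) := quot_pi (- repr q).
Definition quot_mul (q r : quot) := quot_pi (repr q * repr r).
Definition quot_scale (k : R[i]) (q : quot) := quot_pi (k *: repr q).
Definition quot_star (q : quot) := quot_pi (star (repr q)).

Lemma quot_addE x y : quot_add (quot_pi x) (quot_pi y) = quot_pi (x + y).
Proof.
by apply/quot_piP; rewrite opprD addrACA; apply: idealD; exact: quot_repr.
Qed.

Lemma quot_oppE x : quot_opp (quot_pi x) = quot_pi (- x).
Proof. by apply/quot_piP; rewrite -opprD; apply/idealN/quot_repr. Qed.

Lemma quot_mulE x y : quot_mul (quot_pi x) (quot_pi y) = quot_pi (x * y).
Proof.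
apply/quot_piP; set x' := repr _; set y' := repr _.
have -> : x' * y' - x * y = (x' - x) * y' + x * (y' - y).
  by rewrite mulrBl mulrBr addrA subrK.
by apply: idealD; [apply: idealMr|apply: idealMl]; exact: quot_repr.
Qed.

Lemma quot_scaleE k x : quot_scale k (quot_pi x) = quot_pi (k *: x).
Proof. by apply/quot_piP; rewrite -scalerBr; apply/idealZ/quot_repr. Qed.

Lemma quot_starE x : quot_star (quot_pi x) = quot_pi (star x).
Proof. by apply/quot_piP; rewrite -starB; apply/ideal_star/quot_repr. Qed.

Lemma quot_addA : associative quot_add.
Proof.
move=> q r s; have [x ->] := quot_surj q; have [y ->] := quot_surj r; have [z ->] := quot_surj s.
by rewrite !quot_addE addrA.
Qed.

Lemma quot_addC : commutative quot_add.
Proof.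
move=> q r; have [x ->] := quot_surj q; have [y ->] := quot_surj r.
by rewrite !quot_addE addrC.
Qed.

Lemma quot_add0 : left_id (quot_pi 0) quot_add.
Proof. by move=> q; have [x ->] := quot_surj q; rewrite quot_addE add0r. Qed.

Lemma quot_addN : left_inverse (quot_pi 0) quot_opp quot_add.
Proof.
by move=> q; have [x ->] := quot_surj q; rewrite quot_oppE quot_addE addNr.
Qed.

HB.instance Definition _ :=
  GRing.isZmodule.Build quot quot_addA quot_addC quot_add0 quot_addN.

Lemma quot_piD x y : quot_pi (x + y) = quot_pi x + quot_pi y.
Proof. by rewrite -quot_addE. Qed.

Lemma quot_piN x : quot_pi (- x) = - quot_pi x.
Proof. by rewrite -quot_oppE. Qed.

Lemma quot_piB x y : quot_pi (x - y) = quot_pi x - quot_pi y.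
Proof. by rewrite quot_piD quot_piN. Qed.

Lemma quot_pi0 : quot_pi 0 = 0. Proof. by []. Qed.

Lemma quot_mulA : associative quot_mul.
Proof.
move=> q r s; have [x ->] := quot_surj q; have [y ->] := quot_surj r; have [z ->] := quot_surj s.
by rewrite !quot_mulE mulrA.
Qed.

Lemma quot_mul1l : left_id (quot_pi 1) quot_mul.
Proof. by move=> q; have [x ->] := quot_surj q; rewrite quot_mulE mul1r. Qed.

Lemma quot_mul1r : right_id (quot_pi 1) quot_mul.
Proof. by move=> q; have [x ->] := quot_surj q; rewrite quot_mulE mulr1. Qed.

Lemma quot_mulDl : left_distributive quot_mul +%R.
Proof.
move=> q r s; have [x ->] := quot_surj q; have [y ->] := quot_surj r; have [z ->] := quot_surj s.
by rewrite -quot_piD !quot_mulE -quot_piD mulrDl.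
Qed.

Lemma quot_mulDr : right_distributive quot_mul +%R.
Proof.
move=> q r s; have [x ->] := quot_surj q; have [y ->] := quot_surj r; have [z ->] := quot_surj s.
by rewrite -quot_piD !quot_mulE -quot_piD mulrDr.
Qed.

Lemma quot_scaleA k l q : quot_scale k (quot_scale l q) = quot_scale (k * l) q.
Proof. by have [x ->] := quot_surj q; rewrite !quot_scaleE scalerA. Qed.

Lemma quot_scale1 : left_id 1 quot_scale.
Proof. by move=> q; have [x ->] := quot_surj q; rewrite quot_scaleE scale1r. Qed.

Lemma quot_scaleDr : right_distributive quot_scale +%R.
Proof.
move=> k q r; have [x ->] := quot_surj q; have [y ->] := quot_surj r.
by rewrite -quot_piD !quot_scaleE -quot_piD scalerDr.
Qed.

Lemma quot_scaleDl q : {morph quot_scale^~ q : k l / k + l}.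
Proof.
by move=> k l; have [x ->] := quot_surj q; rewrite !quot_scaleE -quot_piD scalerDl.
Qed.

HB.instance Definition _ :=
  GRing.Zmodule_isLmodule.Build R[i] quot quot_scaleA quot_scale1
    quot_scaleDr quot_scaleDl.

Lemma quot_piZ (k : R[i]) x : quot_pi (k *: x) = k *: quot_pi x.
Proof. by rewrite -quot_scaleE. Qed.

(* The quotient norm, first as a real number. *)
Definition quot_rnorm (q : quot) : R :=
  inf [set rnorm x | x in [set x | quot_pi x = q]].

Lemma quot_has_inf q :
  has_inf [set rnorm x | x in [set x | quot_pi x = q]].
Proof.
split; first by exists (rnorm (repr q)), (repr q) => //=; exact: quot_piK.
by exists 0 => _ [x _ <-]; exact: rnorm_ge0.
Qed.

Lemma quot_rnorm_le x : quot_rnorm (quot_pi x) <= rnorm x.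
Proof.
by apply: ge_inf; [have [] := quot_has_inf (quot_pi x)|exists x].
Qed.

Lemma quot_rnorm_lift q (e : R) : 0 < e ->
  exists2 x, quot_pi x = q & rnorm x < quot_rnorm q + e.
Proof.
move=> e0; have [_ [x xq <-] xe] := inf_adherent e0 (quot_has_inf q).
by exists x.
Qed.

Lemma quot_rnorm_ge0 q : 0 <= quot_rnorm q.
Proof.
by apply: lb_le_inf; [have [] := quot_has_inf q|
  move=> _ [x _ <-]; exact: rnorm_ge0].
Qed.

Lemma quot_rnormD q r : quot_rnorm (q + r) <= quot_rnorm q + quot_rnorm r.
Proof.
apply/ler_addgt0Pr => e e0; have e2 : 0 < e / 2 by rewrite divr_gt0.
have [[x <- hx] [y <- hy]] := (quot_rnorm_lift q e2, quot_rnorm_lift r e2).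
rewrite -quot_piD (le_trans (quot_rnorm_le _))// (le_trans (rnormD _ _))//.
by rewrite [e]splitr addrACA lerD// ltW.
Qed.

Lemma quot_rnorm0_eq0 q : quot_rnorm q = 0 -> q = 0.
Proof.
have [x ->] := quot_surj q => h; rewrite -quot_pi0; apply/quot_piP; rewrite subr0.
have [_ _ _ _ clJ] := ideal_closed I.
apply: (closed_rnorm clJ) => d d0.
have [y yx] := quot_rnorm_lift (quot_pi x) d0; rewrite h add0r => yd.
exists (x - y); first by apply/quot_piP.
by rewrite opprB addrC subrK.
Qed.

Lemma quot_rnormZ_le (k : R[i]) q :
  quot_rnorm (k *: q) <= complex.Re `|k| * quot_rnorm q.
Proof.
apply/ler_addgt0Pr => e e0.
have k0 : 0 <= complex.Re `|k| by rewrite normc_def /= sqrtr_ge0.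
have k1 : 0 < complex.Re `|k| + 1 by rewrite ltr_wpDl.
have [x <- hx] := quot_rnorm_lift q (divr_gt0 e0 k1).
rewrite -quot_piZ (le_trans (quot_rnorm_le _))// rnormZ.
apply: (le_trans (ler_wpM2l k0 (ltW hx))); rewrite mulrDr lerD2l.
by rewrite mulrCA ger_pMr// ler_pdivrMr// mul1r lerDl.
Qed.

Lemma Re_norm_real (k : R[i]) : `|k| = (complex.Re `|k|)%:C.
Proof. by rewrite normc_def. Qed.

Lemma quot_rnormZ (k : R[i]) q :
  quot_rnorm (k *: q) = complex.Re `|k| * quot_rnorm q.
Proof.
apply/eqP; rewrite eq_le quot_rnormZ_le andTb.
have [->|k0] := eqVneq k 0.
  by rewrite normr0 [complex.Re 0]/= mul0r quot_rnorm_ge0.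
have nk : complex.Re `|k| != 0.
  apply: contra_neq k0 => nk; apply/eqP; rewrite -normr_eq0 Re_norm_real nk.
  by [].
have nk0 : 0 < complex.Re `|k|.
  by rewrite lt_def nk normc_def /= sqrtr_ge0.
rewrite mulrC -ler_pdivlMr// mulrC.
have -> : (complex.Re `|k|)^-1 = complex.Re `|k^-1|.
  by rewrite normfV [in RHS]Re_norm_real -(fmorphV (real_complex R)).
have {1}-> : q = k^-1 *: (k *: q) by rewrite scalerA mulVf// scale1r.
exact: quot_rnormZ_le.
Qed.

Definition quot_norm q : R[i] := (quot_rnorm q)%:C.

Lemma quot_normD q r : quot_norm (q + r) <= quot_norm q + quot_norm r.
Proof. by rewrite -rmorphD lecR quot_rnormD. Qed.

Lemma quot_normZ (k : R[i]) q : quot_norm (k *: q) = `|k| * quot_norm q.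
Proof. by rewrite Re_norm_real -rmorphM /quot_norm quot_rnormZ. Qed.

Lemma quot_norm0_eq0 q : quot_norm q = 0 -> q = 0.
Proof. by move=> h; apply: quot_rnorm0_eq0; apply: (fmorph_inj (real_complex R)). Qed.

HB.instance Definition _ :=
  Lmodule_isNormed.Build R[i] quot quot_normD quot_normZ quot_norm0_eq0.

Lemma quot_normE q : `|q| = (quot_rnorm q)%:C.
Proof. by []. Qed.

Lemma quot_ballP q r (e : R[i]) : 0 < e ->
  ball q e r <-> quot_rnorm (q - r) < complex.Re e.
Proof.
case: e => a b; rewrite ltcE /= => /andP[/eqP b0 a0].
by rewrite -ball_normE /ball_ /= quot_normE ltcE /= b0 eqxx.
Qed.

Lemma quot_rnormN q : quot_rnorm (- q) = quot_rnorm q.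
Proof. by rewrite -scaleN1r quot_rnormZ normrN normr1 mul1r. Qed.

Lemma quot_complete (F : set_system quot) :
  ProperFilter F -> cauchy F -> cvg F.
Proof.
move=> FF cF; pose r n : R := 2^-1 ^+ n.
have r0 n : 0 < r n by rewrite exprn_gt0// invr_gt0.
have rC n : 0 < (r n)%:C by rewrite ltcR.
have Fp n : exists q, F (ball q (r n)%:C).
  by move/cauchyP : cF => /(_ _ (rC n)).
have [p hp] := choice Fp.
have dist m n : quot_rnorm (p m - p n) < r m + r n.
  have [q [q1 q2]] := filter_ex (filterI (hp m) (hp n)).
  move: q1 q2 => /(quot_ballP _ _ (rC _)) /= q1 /(quot_ballP _ _ (rC _)) /= q2.
  rewrite -(subrKA q); apply: (le_lt_trans (quot_rnormD _ _)).
  by rewrite ltrD// -quot_rnormN opprB.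
have lift n (x : A) : exists y : A, quot_pi x = p n ->
    quot_pi y = p n.+1 /\ rnorm (y - x) < 2 * r n.
  have e0 : 0 < 2 * r n - quot_rnorm (p n.+1 - p n).
    rewrite subr_gt0; apply: (lt_le_trans (dist _ _)).
    by have := r0 n; rewrite /r exprS; set c := _ ^+ n => c0; lra.
  have [z zp zn] := quot_rnorm_lift (p n.+1 - p n) e0.
  exists (x + z) => xp; rewrite quot_piD xp zp addrC subrK; split=> //.
  by rewrite addrAC subrr add0r; move: zn; rewrite addrC subrK.
have {}lift (nx : nat * A) : exists y, quot_pi nx.2 = p nx.1 ->
    quot_pi y = p nx.1.+1 /\ rnorm (y - nx.2) < 2 * r nx.1.
  exact: lift.
have [f hf] := choice lift.
have [x0 hx0] := quot_surj (p 0%N).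
pose u := fix u n : A := if n is m.+1 then f (m, u m) else x0.
have up n : quot_pi (u n) = p n.
  by elim: n => [//|n ih]; have [] := hf (n, u n) ih.
have ustep n : rnorm (u n.+1 - u n) <= 2 * (2^-1) ^+ n.
  by have [_ /ltW] := hf (n, u n) (up n).
have h01 : 0 <= (2^-1 : R) < 1 by apply/andP; split; lra.
have [l hl] := geometric_cvg h01 (ler0n _ 2) ustep.
apply/cvg_ex; exists (quot_pi l); apply/cvg_ballP => e e0.
have re0 : 0 < complex.Re e by move: e0; rewrite ltcE => /andP[].
have e2 : 0 < complex.Re e / 2 by rewrite divr_gt0.
have [N1 h1] := hl _ e2; have [N2 h2] := expr_small h01 e2.
pose n := maxn N1 N2.
apply: filterS (hp n) => q /(quot_ballP _ _ (rC _)) /= qn.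
apply/quot_ballP => //; rewrite -(subrKA (p n)) -{1}up -quot_piB.
apply: (le_lt_trans (quot_rnormD _ _)); rewrite [complex.Re e]splitr.
apply: ltrD.
  by apply: (le_lt_trans (quot_rnorm_le _)); apply: h1; exact: leq_maxl.
by apply: (lt_trans qn); apply: h2; exact: leq_maxr.
Qed.

HB.instance Definition _ := Uniform_isComplete.Build quot quot_complete.

Lemma quot_scaleAl (k : R[i]) (q r : quot) :
  k *: quot_mul q r = quot_mul (k *: q) r.
Proof.
have [x ->] := quot_surj q; have [y ->] := quot_surj r.
by rewrite -quot_piZ !quot_mulE -quot_piZ cscalerAl.
Qed.

Lemma quot_scaleAr (k : R[i]) (q r : quot) :
  k *: quot_mul q r = quot_mul q (k *: r).
Proof.
have [x ->] := quot_surj q; have [y ->] := quot_surj r.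
by rewrite -quot_piZ !quot_mulE -quot_piZ cscalerAr.
Qed.

Lemma quot_starK : involutive quot_star.
Proof. by move=> q; have [x ->] := quot_surj q; rewrite !quot_starE starK. Qed.

Lemma quot_starD : {morph quot_star : q r / q + r}.
Proof.
move=> q r; have [x ->] := quot_surj q; have [y ->] := quot_surj r.
by rewrite -quot_piD !quot_starE -quot_piD starD.
Qed.

Lemma quot_starZ (k : R[i]) q : quot_star (k *: q) = conjc k *: quot_star q.
Proof.
by have [x ->] := quot_surj q; rewrite -quot_piZ !quot_starE -quot_piZ starZ.
Qed.

Lemma quot_starM q r :
  quot_star (quot_mul q r) = quot_mul (quot_star r) (quot_star q).
Proof.
have [x ->] := quot_surj q; have [y ->] := quot_surj r.
by rewrite quot_mulE !quot_starE quot_mulE starM.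
Qed.

Lemma quot_rnormM q r :
  quot_rnorm (quot_mul q r) <= quot_rnorm q * quot_rnorm r.
Proof.
have h e : 0 < e -> e <= 1 -> quot_rnorm (quot_mul q r) -
    quot_rnorm q * quot_rnorm r <= (quot_rnorm q + quot_rnorm r + 1) * e.
  move=> e0 e1.
  have [x xq xe] := quot_rnorm_lift q e0; have [y yr ye] := quot_rnorm_lift r e0.
  rewrite -{1}xq -{1}yr quot_mulE lerBlDr.
  apply: (le_trans (quot_rnorm_le _)); apply: (le_trans (rnormM _ _)).
  apply: (le_trans (ler_pM (rnorm_ge0 _) (rnorm_ge0 _) (ltW xe) (ltW ye))).
  have := ler_wpM2l (ltW e0) e1; move: (quot_rnorm q) (quot_rnorm r) => a b h; lra.
rewrite -subr_le0.
apply: (@small_le0 _ _ (quot_rnorm q + quot_rnorm r + 1 +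
   `|quot_rnorm (quot_mul q r)|)).
  by rewrite !addr_ge0// quot_rnorm_ge0.
move=> e e0; have [e1|/ltW e1] := leP e 1.
  by apply: (le_trans (h e e0 e1)); rewrite ler_wpM2r ?(ltW e0)// lerDl.
rewrite ger0_norm ?quot_rnorm_ge0//.
have := quot_rnorm_ge0 q; have := quot_rnorm_ge0 r.
have := quot_rnorm_ge0 (quot_mul q r).
move: (quot_rnorm _) (quot_rnorm q) (quot_rnorm r) => c a b c0 b0 a0.
have ab0 : 0 <= a * b by rewrite mulr_ge0.
have c1 : c <= c * e by rewrite ler_peMr.
have ab1 : 0 <= (a + b + 1) * e by rewrite mulr_ge0 ?(ltW e0)// !addr_ge0.
by rewrite [leRHS]mulrDl; lra.
Qed.

Lemma quot_rnorm_star_le q : quot_rnorm (quot_star q) <= quot_rnorm q.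
Proof.
apply/ler_addgt0Pr => e e0; have [x <- /ltW xe] := quot_rnorm_lift q e0.
by rewrite quot_starE (le_trans (quot_rnorm_le _))// rnorm_star.
Qed.

Lemma quot_rnorm_star q : quot_rnorm (quot_star q) = quot_rnorm q.
Proof.
apply/eqP; rewrite eq_le quot_rnorm_star_le/=.
by rewrite -{1}[q]quot_starK quot_rnorm_star_le.
Qed.

Lemma quot_rnorm_starM q :
  quot_rnorm (quot_mul (quot_star q) q) = quot_rnorm q ^+ 2.
Proof.
apply/eqP; rewrite eq_le; apply/andP; split.
  by rewrite expr2 -{1}(quot_rnorm_star q) quot_rnormM.
have [x ->] := quot_surj q; rewrite quot_starE quot_mulE.
apply/ler_addgt0Pr => d d0; have d2 : 0 < d / 2 by rewrite divr_gt0.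
have [y yx /ltW yd] := quot_rnorm_lift (quot_pi (star x * x)) d2.
pose j := 2^-1%:C *: (y + star y) - star x * x.
have sc : conjc (2^-1%:C : R[i]) = 2^-1%:C by rewrite /= oppr0.
have sj : star j = j.
  by rewrite /j starB starZ sc starD starK starM starK [star y + y]addrC.
have Jj : J j.
  have Jy : J (y - star x * x) by apply/quot_piP.
  have -> : j = 2^-1%:C *: ((y - star x * x) + star (y - star x * x)).
    rewrite /j starB starM starK addrACA -opprD scalerBr; congr (_ - _).
    rewrite -[in RHS](scale1r (star x * x)) -scalerDl scalerA.
    rewrite -(rmorph1 (real_complex R)) -rmorphD -rmorphM.
    have -> : 2^-1 * (1 + 1) = 1 :> R by field.
    by rewrite scale1r.
  by apply/idealZ/idealD => //; exact: ideal_star.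
have [e [w [se ne ew he]]] := approx_unit sj d2.
have nj : rnorm (star x * x + j) <= quot_rnorm (quot_pi (star x * x)) + d / 2.
  apply: le_trans yd; rewrite /j addrC subrK rnormZr ger0_norm ?invr_ge0//.
  rewrite ler_pdivrMl//; apply: (le_trans (rnormD _ _)).
  by rewrite rnorm_star mulr_natl mulr2n.
have xe : quot_pi x = quot_pi (x * e).
  apply/quot_piP; rewrite -{1}[x]mulr1 -mulrBr ew.
  by apply/idealMl/idealMl.
rewrite xe; apply: (@le_trans _ _ (rnorm (x * e) ^+ 2)).
  by rewrite ler_pXn2r ?nnegrE ?rnorm_ge0 ?quot_rnorm_ge0// quot_rnorm_le.
rewrite -rnorm_starM starM se.
have -> : e * star x * (x * e) = e * ((star x * x + j) * e) - e * (j * e).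
  by rewrite -mulrBr -mulrBl addrK !mulrA.
apply: (le_trans (rnormD _ _)); rewrite rnormN [d]splitr [leRHS]addrA.
apply: lerD.
  apply: le_trans nj; apply: (le_trans (rnormM _ _)).
  rewrite (le_trans (ler_piMl (rnorm_ge0 _) ne))//.
  apply: (le_trans (rnormM _ _)); exact: ler_piMr (rnorm_ge0 _) ne.
apply: le_trans he; apply: (le_trans (rnormM _ _)).
exact: ler_piMl (rnorm_ge0 _) ne.
Qed.

Lemma quot_normM (q r : quot) : `|quot_mul q r| <= `|q| * `|r|.
Proof. by rewrite !quot_normE -rmorphM lecR quot_rnormM. Qed.

Lemma quot_norm_starM (q : quot) : `|quot_mul (quot_star q) q| = `|q| ^+ 2.
Proof. by rewrite !quot_normE -rmorphXn; congr (_%:C); exact: quot_rnorm_starM. Qed.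

Definition quotient_cstar : unitalCstar R :=
  @UnitalCstar R quot quot_mul (quot_pi 1) quot_star quot_mulA quot_mul1l
    quot_mul1r quot_mulDl quot_mulDr quot_scaleAl quot_scaleAr quot_starK
    quot_starD quot_starZ quot_starM quot_normM quot_norm_starM.

End IdealTheory.

Definition unital_star_hom (R : realType) (A B : unitalCstar R) (h : A -> B) :=
  [/\ forall (k : R[i]) x y, h (k *: x + y) = k *: h x + h y,
      h 1 = 1, forall x y, h (x * y) = h x * h y
    & forall x, h (star x) = star (h x)].

Definition cstar_isomorphic (R : realType) (A B : unitalCstar R) :=
  exists h : A -> B, unital_star_hom h /\ bijective h.

Record normedSet (R : realType) := NormedSet {
  nset_sort :> Type;
  nsize : nset_sort -> R;
  nsize_ge0 : forall s, 0 <= nsize s }.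

Definition contractive (R : realType) (S T : normedSet R) (phi : S -> T) :=
  forall s, nsize (phi s) <= nsize s.

Definition cstar_nset (R : realType) (A : unitalCstar R) : normedSet R :=
  NormedSet (@rnorm_ge0 R A).

Definition is_disjoint_union (R : realType) (S T U : normedSet R)
    (i : S -> U) (j : T -> U) :=
  [/\ bijective (fun x : S + T => match x with inl s => i s | inr t => j t end),
      forall s, nsize (i s) = nsize s & forall t, nsize (j t) = nsize t].

(* A model of 1C*Alg(S, f), which the universal property determines up to a
   unique isomorphism. *)
Record scaledFree (R : realType) (S : normedSet R) := ScaledFree {
  free_alg :> unitalCstar R;
  free_gen : S -> free_alg;
  free_gen_contractive : @contractive R S (cstar_nset free_alg) free_gen;
  free_universal : forall (B : unitalCstar R) (phi : S -> B),
    @contractive R S (cstar_nset B) phi ->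
    exists! h : free_alg -> B,
      unital_star_hom h /\ forall s, h (free_gen s) = phi s }.

Record presentation (R : realType) := Presentation {
  generators : normedSet R;
  free_cstar : scaledFree generators;
  relations : set free_cstar }.
Arguments relations {R} p.
Arguments free_gen {R S} F _ : rename.

Definition presented (R : realType) (P : presentation R) : unitalCstar R :=
  quotient_cstar (gen_ideal (relations P)).

Definition add_relations (R : realType) (P P' : presentation R) :=
  exists Q : set (free_cstar P),
    Q `<=` ideal_set (gen_ideal (relations P)) /\
    P' = Presentation (relations P `|` Q).

(* T is the normed set of new symbols and t : T stands for the element g t.
   The family g need not be injective: several new symbols may be attached to
   one element.  With a single symbol per element, finitely many
   transformations never lead from the empty presentation of the complex
   numbers to the one with f = 0 on a generating set of cardinality greater
   than the continuum and no relations, which also presents them.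
   As P' is only required to have a disjoint union as its set of generators,
   names of generators and models of the free algebras are immaterial. *)
Definition add_generators (R : realType) (P P' : presentation R) :=
  exists (T : normedSet R) (g : T -> free_cstar P)
      (rho : generators P -> generators P') (sym : T -> generators P')
      (rho_hat : free_cstar P -> free_cstar P'),
    [/\ forall t, `|g t| <= (nsize t)%:C,
        is_disjoint_union rho sym,
        unital_star_hom rho_hat,
        forall s, rho_hat (free_gen (free_cstar P) s) = free_gen (free_cstar P') (rho s)
      & relations P' = (rho_hat @` relations P) `|`
          [set free_gen (free_cstar P') (sym t) - rho_hat (g t) | t in [set: T]]].

Definition tietze (R : realType) (P P' : presentation R) :=
  [\/ add_relations P P', add_relations P' P,
      add_generators P P' | add_generators P' P].

(* Main.v *)
Require Import Defs.
From HB Require Import structures.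
From mathcomp Require Import all_boot all_order all_algebra.
From mathcomp Require Import complex.
From mathcomp Require Import all_classical reals topology normedtype sequences.
From mathcomp Require Import ring lra.

(** A presented algebra is unchanged when redundant relations are added, and
    sending each redundant generator to its defining element retracts the larger
    free algebra onto the smaller one, with the same quotient.  Conversely, let
    [h : A1 -> A2] be an isomorphism, [F] the free algebra on the disjoint union
    of the generators, and [psi : F -> A2] the homomorphism given by [h] on the
    first generators and by the quotient map on the second.  Lifting [psi] of the
    second generators to the free algebra on the first ones, without increasing
    norms, adds them to the first presentation; the ideal of the relations
    obtained is the kernel of [psi].  Symmetrically for the second presentation,
    so the two enlarged presentations have the same ideal and are joined through
    the union of their relations.

    The norm-preserving lift in a quotient uses the quintic
    [p |-> p (5 - (p* p)^2) / 4], which maps the unit ball onto itself, and in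
    fact maps the ball of radius 1.1 into the unit ball: a lift of norm at most
    1.1 of a preimage under the quintic is sent by the quintic to an exact lift.
    The free algebra is the set of Cauchy sequences of *-polynomials for the
    supremum of the seminorms of all contractive representations, up to
    equality of limits. *)

Set Implicit Arguments.
Unset Strict Implicit.
Unset Printing Implicit Defensive.

Import Order.TTheory GRing.Theory Num.Theory.
Import numFieldNormedType.Exports.

Local Open Scope classical_set_scope.
Local Open Scope complex_scope.
Local Open Scope ring_scope.
Local Open Scope quotient_scope.

(** * Norm limits and square roots *)

Section Limits.
Variables (R : realType) (A : unitalCstar R).
Implicit Types (x y l : A) (u v : nat -> A).

(** This is the form of convergence that [complete_rnorm] delivers, in the real-valued norm. *)
Definition rcvg u l := forall e : R, 0 < e ->
  exists N, forall n, (N <= n)%N -> rnorm (l - u n) < e.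

Lemma rcvg_cst x : rcvg (fun=> x) x.
Proof. by move=> e e0; exists 0%N => n _; rewrite subrr rnorm0. Qed.

Lemma rcvg_unique u l l' : rcvg u l -> rcvg u l' -> l = l'.
Proof.
move=> ul ul'; apply/eqP; rewrite -subr_eq0; apply/eqP/rnorm0_eq0/eqP.
rewrite eq_le rnorm_ge0 andbT; apply: (@small_le0 _ _ 2) => // e e0.
have [N h] := ul _ e0; have [N' h'] := ul' _ e0.
apply: (le_trans (rnorm_tri _ (u (maxn N N')) _)).
rewrite [X in _ + X]rnormBC mulr_natl mulr2n.
by apply: lerD; apply: ltW; [apply: h|apply: h']; rewrite ?leq_maxl ?leq_maxr.
Qed.

Lemma rcvgS u l : rcvg u l -> rcvg (fun n => u n.+1) l.
Proof.
by move=> ul e e0; have [N h] := ul _ e0; exists N => n Nn; exact/h/leqW.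
Qed.

Lemma rcvgD u v l l' : rcvg u l -> rcvg v l' ->
  rcvg (fun n => u n + v n) (l + l').
Proof.
move=> ul vl e e0; have e2 : 0 < e / 2 by rewrite divr_gt0.
have [N h] := ul _ e2; have [N' h'] := vl _ e2; exists (maxn N N') => n.
rewrite geq_max => /andP[Nn Nn']; rewrite opprD addrACA.
by apply: (le_lt_trans (rnormD _ _)); rewrite [e]splitr ltrD ?h ?h'.
Qed.

Lemma rcvgM u v l l' : rcvg u l -> rcvg v l' ->
  rcvg (fun n => u n * v n) (l * l').
Proof.
move=> ul vl e e0.
have K0 : 0 < rnorm l' + (rnorm l + 1).
  by rewrite ltr_wpDl ?rnorm_ge0// ltr_wpDl ?rnorm_ge0.
have e1 : 0 < e / (rnorm l' + (rnorm l + 1)) by rewrite divr_gt0.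
have [N h] := ul _ e1; have [N' h'] := vl _ e1; have [M k] := ul _ (@ltr01 R).
exists (maxn M (maxn N N')) => n; rewrite !geq_max => /and3P[Mn Nn Nn'].
have -> : l * l' - u n * v n = (l - u n) * l' + u n * (l' - v n).
  by rewrite mulrBl mulrBr subrKA.
have un : rnorm (u n) <= rnorm l + 1.
  rewrite -[u n](subrK l) addrC (le_trans (rnormD _ _))// lerD2l.
  by rewrite rnormBC ltW// k.
have {}h := h _ Nn; have {}h' := h' _ Nn'.
apply: (le_lt_trans (rnormD _ _)).
apply: (@le_lt_trans _ _ (rnorm (l - u n) * rnorm l'
    + (rnorm l + 1) * rnorm (l' - v n))).
  by rewrite lerD ?rnormM// (le_trans (rnormM _ _))// ler_wpM2r// rnorm_ge0.
set d := e / _ in h h' e1; have -> : e = rnorm l' * d + (rnorm l + 1) * d.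
  by rewrite -mulrDl mulrC divfK// gt_eqF.
apply: ler_ltD; first by rewrite mulrC ler_wpM2l ?rnorm_ge0 ?ltW.
by rewrite ltr_pM2l// ltr_wpDl// rnorm_ge0.
Qed.

Lemma rcvgX u l n : rcvg u l -> rcvg (fun m => u m ^+ n) (l ^+ n).
Proof.
move=> ul; elim: n => [|n ih]; first exact: rcvg_cst.
have -> : (fun m => u m ^+ n.+1) = (fun m => u m * u m ^+ n).
  by apply/funext => m; rewrite exprS.
by rewrite exprS; exact: rcvgM.
Qed.

Lemma rcvg_scale u l (k : R[i]) : rcvg u l -> rcvg (fun n => k *: u n) (k *: l).
Proof.
move=> /(rcvgM (rcvg_cst (k *: (1 : A)))); rewrite -cscalerAl mul1r.
by under eq_fun do rewrite -cscalerAl mul1r.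
Qed.

Lemma rcvg_star u l : rcvg u l -> rcvg (fun n => star (u n)) (star l).
Proof.
move=> ul e e0; have [N h] := ul _ e0; exists N => n /h.
by rewrite -starB rnorm_star.
Qed.

Lemma rcvg_rnorm_le u l M : rcvg u l -> (forall n, rnorm (u n) <= M) ->
  rnorm l <= M.
Proof.
move=> ul uM; apply/ler_addgt0Pr => e e0; have [N h] := ul _ e0.
rewrite -[l](subrK (u N)) addrC (le_trans (rnormD _ _))// lerD//.
exact/ltW/h.
Qed.

(** The splitting x^(n+1) - y^(n+1) = x (x^n - y^n) + (x - y) y^n holds for elements and scalars
    alike, and the bounds compare summand by summand. *)
Lemma rnorm_subrX x y (a b : R) n : rnorm x <= a -> rnorm y <= b ->
  rnorm (x - y) <= a - b -> rnorm (x ^+ n - y ^+ n) <= a ^+ n - b ^+ n.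
Proof.
move=> xa yb xy.
have a0 : 0 <= a := le_trans (rnorm_ge0 _) xa.
elim: n => [|n ih]; first by rewrite !expr0 !subrr rnorm0.
have -> : x ^+ n.+1 - y ^+ n.+1 = x * (x ^+ n - y ^+ n) + (x - y) * y ^+ n.
  by rewrite !exprS mulrBr mulrBl subrKA.
have -> : a ^+ n.+1 - b ^+ n.+1 = a * (a ^+ n - b ^+ n) + (a - b) * b ^+ n.
  by rewrite !exprS; ring.
apply: (le_trans (rnormD _ _)); apply: lerD; apply: (le_trans (rnormM _ _)).
  by apply: ler_pM; rewrite ?rnorm_ge0.
apply: ler_pM; rewrite ?rnorm_ge0// (le_trans (rnormX _ _))//.
by rewrite lerXn2r ?nnegrE ?rnorm_ge0// (le_trans (rnorm_ge0 _) yb).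
Qed.

End Limits.

(** * Fixed points, square roots and unitaries *)

Section FixedPoint.
Variables (R : realType) (A : unitalCstar R).
Implicit Types (u v k z : A).

(* The iterates of [x |-> u + v x^n] from 0 are dominated by those of
   [t |-> |u| + |v| t^n], which increase and stay below 1. *)
Lemma fixed_point u v n : star u = u -> star v = v -> u * v = v * u ->
  rnorm u + rnorm v <= 1 ->
  exists k, [/\ star k = k, k = u + v * k ^+ n, rnorm k <= 1 &
    forall z, z * u = u * z -> z * v = v * z -> z * k = k * z].
Proof.
move=> su sv uv uv1.
pose k m := iter m (fun x => u + v * x ^+ n) 0.
pose c m : R := iter m (fun x => rnorm u + rnorm v * x ^+ n) 0.
have c0 m : 0 <= c m.
  by elim: m => [//|m ih] /=; rewrite addr_ge0 ?mulr_ge0 ?rnorm_ge0 ?exprn_ge0.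
have c1 m : c m <= 1.
  elim: m => [|m ih] /=; first exact: ler01.
  by rewrite (le_trans _ uv1)// lerD2l ler_piMr ?rnorm_ge0// exprn_ile1.
have kc m : rnorm (k m) <= c m.
  elim: m => [|m ih] /=; first by rewrite rnorm0.
  rewrite (le_trans (rnormD _ _))// lerD2l (le_trans (rnormM _ _))//.
  rewrite ler_wpM2l ?rnorm_ge0// (le_trans (rnormX _ _))//.
  by rewrite lerXn2r ?nnegrE ?rnorm_ge0.
have kS m : rnorm (k m.+1 - k m) <= c m.+1 - c m.
  elim: m => [|m ih]; first by rewrite !subr0; exact: (kc 1%N).
  have E x y : u + v * x - (u + v * y) = v * (x - y).
    by rewrite opprD addrACA subrr add0r mulrBr.
  have -> : k m.+2 - k m.+1 = v * (k m.+1 ^+ n - k m ^+ n) by rewrite -E.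
  have -> : c m.+2 - c m.+1 = rnorm v * (c m.+1 ^+ n - c m ^+ n).
    by rewrite /c !iterS; ring.
  rewrite (le_trans (rnormM _ _))// ler_wpM2l ?rnorm_ge0//.
  exact: rnorm_subrX.
have kD m p : rnorm (k (m + p)%N - k m) <= c (m + p)%N - c m.
  elim: p => [|p ih]; first by rewrite addn0 !subrr rnorm0.
  rewrite addnS (le_trans (rnorm_tri _ (k (m + p)%N) _))//.
  by rewrite (le_trans (lerD (kS _) ih))// subrKA.
(* The sum |u| + |v| may equal 1, so the iteration need not contract; the iterates are Cauchy
   because the dominating sequence [c] is bounded and comes close to its supremum. *)
have sup_c : has_sup (range c).
  by split; [exists (c 0%N), 0%N | exists 1 => _ [m _ <-]].
have cs m : c m <= sup (range c) by apply: ub_le_sup; [case: sup_c|exists m].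
have [|l kl] := @complete_rnorm _ _ k.
  move=> e e0; have e2 : 0 < e / 2 by rewrite divr_gt0.
  have [_ [N _ <-] cN] := sup_adherent e2 sup_c.
  have kN m : (N <= m)%N -> rnorm (k m - k N) < e / 2.
    move=> Nm; rewrite -(subnKC Nm) (le_lt_trans (kD _ _))//.
    by rewrite ltrBlDl -ltrBlDr (le_lt_trans _ cN)// lerD2r cs.
  exists N => m p /kN hm /kN hp.
  rewrite (le_lt_trans (rnorm_tri _ (k N) _))// [e]splitr ltrD//.
  by rewrite rnormBC.
(* Both properties go through one induction: self-adjointness of [v * k m ^+ n] uses that [v]
   commutes with [k m]. *)
have kP m : star (k m) = k m /\
    forall z, z * u = u * z -> z * v = v * z -> z * k m = k m * z.
  elim: m => [|m [sk ck]]; first by split=> [|z _ _]; rewrite ?star0 ?mulr0 ?mul0r.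
  have kX z p : z * k m = k m * z -> z * k m ^+ p = k m ^+ p * z.
    move=> zk; elim: p => [|p ih]; first by rewrite expr0 mulr1 mul1r.
    by rewrite exprS mulrA zk -mulrA ih mulrA.
  have sX p : star (k m ^+ p) = k m ^+ p.
    elim: p => [|p ih]; first by rewrite !expr0 star1.
    by rewrite exprS starM ih sk kX.
  split=> [|z zu zv] /=.
    by rewrite starD starM su sv sX kX// -ck.
  by rewrite mulrDr mulrDl zu mulrA zv -!mulrA kX// ck.
exists l; split.
- apply: rcvg_unique (rcvg_star kl) _.
  by under eq_fun do rewrite (kP _).1.
- apply: rcvg_unique (rcvgS kl) _.
  by apply: rcvgD (rcvg_cst _) (rcvgM (rcvg_cst _) (rcvgX _ kl)).
- by apply: rcvg_rnorm_le kl _ => m; exact: le_trans (kc m) (c1 m).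
- move=> z zu zv; apply: rcvg_unique (rcvgM (rcvg_cst _) kl) _.
  under eq_fun do rewrite (kP _).2//.
  exact: rcvgM kl (rcvg_cst _).
Qed.

Lemma half_double (x : A) : 2^-1%:C *: (x + x) = x.
Proof.
rewrite -mulr2n -[x *+ 2]scaler_nat scalerA.
by rewrite -(rmorph_nat (real_complex R)) -rmorphM mulVf ?pnatr_eq0// rmorph1 scale1r.
Qed.

(* [1 - c] is a fixed point of [x |-> (y + x^2) / 2]. *)
Lemma exists_sqrt y : star y = y -> rnorm y <= 1 ->
  exists c : A, [/\ star c = c, c * c = 1 - y &
    forall z, z * y = y * z -> z * c = c * z].
Proof.
move=> sy y1.
have sh x : star x = x -> star (2^-1%:C *: x) = 2^-1%:C *: x.
  by move=> sx; rewrite starZ sx /= oppr0.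
have [] := @fixed_point (2^-1%:C *: y) (2^-1%:C *: (1 : A)) 2.
- exact: sh.
- exact/sh/star1.
- by rewrite -!cscalerAr -!cscalerAl mulr1 mul1r.
- rewrite !rnormZr -mulrDr gtr0_norm ?invr_gt0// ler_pdivrMl// mulr1.
  by rewrite -[2]/(1 + 1) lerD// rnorm1_le.
move=> k [sk kE _ kC]; exists (1 - k); split.
- by rewrite starB star1 sk.
- have kk : k + k = y + k * k.
    by rewrite {1 2}kE -cscalerAl mul1r expr2 -scalerDr -scalerDr half_double.
  rewrite mulrBl mul1r mulrBr mulr1 opprB -addrA; congr (_ + _).
  by rewrite addrCA -opprD kk opprD addrCA subrr addr0.
- move=> z zy; rewrite mulrBr mulrBl mulr1 mul1r kC//.
    by rewrite -cscalerAr -cscalerAl zy.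
  by rewrite -cscalerAr -cscalerAl mulr1 mul1r.
Qed.

(* [d + i v] is unitary. *)
Lemma pythagoras (d v : A) : star d = d -> star v = v -> d * v = v * d ->
  d * d + v * v = 1 -> rnorm d <= 1.
Proof.
move=> sd sv dv dv1; pose w := d + 'i *: v.
have sw : star w = d - 'i *: v.
  rewrite starD starZ sd sv; congr (_ + _); rewrite -scaleNr; congr (_ *: _).
  by apply/eqP; rewrite eq_complex /= oppr0 !eqxx.
have w1 : rnorm w <= 1.
  rewrite -(@ler_pXn2r _ 2) ?nnegrE ?rnorm_ge0// expr1n -rnorm_starM sw.
  suff -> : (d - 'i *: v) * w = 1 by exact: rnorm1_le.
  rewrite /w mulrDr !mulrBl -!cscalerAl -!cscalerAr dv addrA subrK.
  have -> : 'i *: ('i *: (v * v)) = - (v * v).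
    by rewrite scalerA -[X in X *: _]expr2 sqr_i scaleN1r.
  by rewrite opprK.
have -> : d = 2^-1%:C *: (w + star w).
  by rewrite sw /w addrACA subrr addr0 half_double.
rewrite rnormZr gtr0_norm ?invr_gt0// ler_pdivrMl// mulr1.
by rewrite (le_trans (rnormD _ _))// rnorm_star -[2]/(1 + 1) lerD.
Qed.

End FixedPoint.

(** * Homomorphisms and norm-preserving lifts *)

Section PolynomialCalculus.
Variables (R : realType) (A : unitalCstar R) (a : A).
Implicit Types p q : {poly R[i]}.

(** Expressions in [a] become images of commutative polynomials, so that identities and commutations
    between them reduce to [ring] and [mulrC]. *)
Definition peval (p : {poly R[i]}) : A := \sum_(i < size p) p`_i *: a ^+ i.

Lemma peval_widen p n : (size p <= n)%N ->
  peval p = \sum_(i < n) p`_i *: a ^+ i.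
Proof.
move=> pn; rewrite /peval (big_ord_widen n (fun i => p`_i *: a ^+ i))//.
rewrite big_mkcond; apply: eq_bigr => i _; case: ltnP => // /leq_sizeP.
by move=> /(_ i (leqnn _)) ->; rewrite scale0r.
Qed.

Lemma pevalD p q : peval (p + q) = peval p + peval q.
Proof.
have [sp sq] := (leq_maxl (size p) (size q), leq_maxr (size p) (size q)).
rewrite (peval_widen (size_polyD p q)) (peval_widen sp) (peval_widen sq).
by rewrite -big_split; apply: eq_bigr => i _; rewrite coefD scalerDl.
Qed.

Lemma pevalZ k p : peval (k *: p) = k *: peval p.
Proof.
rewrite (peval_widen (size_scale_leq k p)) scaler_sumr.
by apply: eq_bigr => i _; rewrite coefZ scalerA.
Qed.

Lemma pevalB p q : peval (p - q) = peval p - peval q.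
Proof. by rewrite pevalD -scaleN1r pevalZ scaleN1r. Qed.

Lemma pevalC k : peval k%:P = k *: (1 : A).
Proof.
rewrite (peval_widen (size_polyC_leq1 k)) big_ord_recl big_ord0 coefC.
by rewrite addr0.
Qed.

Lemma peval_n n : peval n%:R = n%:R.
Proof. by rewrite -polyC_natr pevalC scaler_nat. Qed.

Lemma pevalMX p : peval (p * 'X) = peval p * a.
Proof.
have sp : (size (p * 'X)%R <= (size p).+1)%N.
  by rewrite (leq_trans (size_polyMleq _ _))// size_polyX addn2.
rewrite (peval_widen sp) big_ord_recl coefMX scale0r add0r mulr_suml.
by apply: eq_bigr => i _; rewrite coefMX -cscalerAl exprSr.
Qed.

Lemma pevalX : peval 'X = a.
Proof. by rewrite -['X]mul1r pevalMX (peval_n 1) mul1r. Qed.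

Lemma peval_comm p x : x * a = a * x -> x * peval p = peval p * x.
Proof.
move=> xa; rewrite mulr_sumr mulr_suml; apply: eq_bigr => i _.
rewrite -cscalerAl -cscalerAr; congr (_ *: _).
elim: (val i) => [|n ih]; first by rewrite mulr1 mul1r.
by rewrite exprS mulrA xa -!mulrA ih.
Qed.

Lemma pevalM p q : peval (p * q) = peval p * peval q.
Proof.
elim/poly_ind: p => [|p c ih].
  by rewrite mul0r -(scale0r 0) pevalZ scale0r mul0r.
rewrite [in LHS]mulrDl !pevalD [RHS]mulrDl; congr (_ + _).
  by rewrite mulrAC !pevalMX ih -!mulrA peval_comm.
by rewrite mul_polyC pevalZ pevalC -cscalerAl mul1r.
Qed.

Lemma pevalXn p n : peval (p ^+ n) = peval p ^+ n.
Proof. by elim: n => [|n ih]; rewrite ?(peval_n 1)// !exprS pevalM ih. Qed.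

End PolynomialCalculus.

(** * Contractivity of unital *-homomorphisms *)

Section Homomorphisms.
Variables (R : realType) (A B : unitalCstar R) (h : A -> B).
Hypothesis hh : unital_star_hom h.

Lemma homD x y : h (x + y) = h x + h y.
Proof. by have [hl _ _ _] := hh; rewrite -[x in LHS]scale1r hl scale1r. Qed.

Lemma hom0 : h 0 = 0.
Proof. by apply/(addrI (h 0)); rewrite -homD !addr0. Qed.

Lemma homZ (k : R[i]) x : h (k *: x) = k *: h x.
Proof. by have [hl _ _ _] := hh; rewrite -[_ *: x]addr0 hl hom0 addr0. Qed.

Lemma homB x y : h (x - y) = h x - h y.
Proof. by rewrite homD -scaleN1r homZ scaleN1r. Qed.

(** Square roots replace spectral theory. Self-adjoint elements of norm below 1 come first, then all
    self-adjoint ones by scaling, then any [x] through the C*-identity for [star x * x]. *)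
Lemma hom_contractive x : rnorm (h x) <= rnorm x.
Proof.
have [hl h1 hM hs] := hh.
(* [y] is the real part of a unitary [y + i c], and so is its image. *)
have unit_ball y : star y = y -> rnorm y < 1 -> rnorm (h y) <= 1.
  move=> sy /ltW y1.
  have [||c [sc cc cC]] := @exists_sqrt R A (y * y).
  - by rewrite starM sy.
  - by rewrite (le_trans (rnormM _ _))// mulr_ile1 ?rnorm_ge0.
  apply: (@pythagoras _ _ _ (h c)); rewrite -?hs ?sy ?sc -?hM//.
    by rewrite cC// mulrA.
  by rewrite -homD cc addrC subrK.
have self_adjoint y : star y = y -> rnorm (h y) <= rnorm y.
  move=> sy; apply/ler_addgt0Pr => e e0.
  have K0 : 0 < rnorm y + e by rewrite ltr_wpDl ?rnorm_ge0.
  have := unit_ball ((rnorm y + e)^-1%:C *: y).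
  rewrite starZ sy homZ !rnormZr gtr0_norm ?invr_gt0//.
  rewrite ler_pdivrMl// ltr_pdivrMl// mulr1; apply; last by rewrite ltrDl.
  by rewrite /= oppr0.
rewrite -(@ler_pXn2r _ 2) ?nnegrE ?rnorm_ge0// -!rnorm_starM -hs -hM.
by rewrite self_adjoint// starM starK.
Qed.

End Homomorphisms.

Lemma rnorm_closed (R : realType) (A : unitalCstar R) (J : set A) :
  (forall x, (forall e : R, 0 < e -> exists2 z, J z & rnorm (x - z) < e) -> J x) ->
  closed J.
Proof.
move=> hJ x Jx; apply: hJ => e e0.
have eC : 0 < e%:C by rewrite ltcR.
have [z [Jz /(ballP _ _ eC) xz]] := Jx _ (nbhsx_ballx x _ eC).
by exists z.
Qed.

(** Contractivity of [h] is what makes the preimage closed. *)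
Lemma preimage_ideal (R : realType) (A B : unitalCstar R) (h : A -> B)
    (J : closed_ideal B) :
  unital_star_hom h -> is_closed_ideal (h @^-1` ideal_set J).
Proof.
move=> hh; have [_ _ hM _] := hh; split => /=.
- by rewrite (hom0 hh); exact: ideal0.
- by move=> x y; rewrite (homD hh); exact: idealD.
- by move=> a x; rewrite hM; exact: idealMl.
- by move=> a x; rewrite hM; exact: Defs.idealMr.
- apply: rnorm_closed => x hx; have [_ _ _ _ clJ] := ideal_closed J.
  apply: (closed_rnorm clJ) => e /hx[z Jz xz]; exists (h z) => //.
  by rewrite -(homB hh) (le_lt_trans (hom_contractive hh _)).
Qed.

(** The preimage of [J] is one of the closed ideals whose intersection is the generated ideal, so
    inclusions need checking on generators only. *)
Lemma gen_ideal_sub (R : realType) (A B : unitalCstar R) (h : A -> B)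
    (X : set A) (J : closed_ideal B) :
  unital_star_hom h -> (forall x, X x -> ideal_set J (h x)) ->
  forall x, ideal_set (gen_ideal X) x -> ideal_set J (h x).
Proof.
move=> hh XJ x hx; apply: (hx (h @^-1` ideal_set J)).
by split; [exact: preimage_ideal|exact: XJ].
Qed.

Lemma sub_gen_ideal (R : realType) (A : unitalCstar R) (X : set A) :
  X `<=` ideal_set (gen_ideal X).
Proof. by move=> x Xx J [_ XJ]; exact: XJ. Qed.

Lemma quot_pi_hom (R : realType) (A : unitalCstar R) (I : closed_ideal A) :
  unital_star_hom (quot_pi I : A -> quotient_cstar I).
Proof.
split=> [k x y||x y|x] //.
- by rewrite quot_piD quot_piZ.
- by rewrite -quot_mulE.
- by rewrite -quot_starE.
Qed.

(** * Lifts that do not increase the norm *)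

Section Lifting.
Variable R : realType.

(** On scalars t >= 0 this is t (5 - t^4) / 4, whose maximum is the value 1 at t = 1. The derivative
    vanishes there, which leaves room for radii slightly above 1. *)
Definition quintic (A : unitalCstar R) (p : A) : A :=
  4^-1%:C *: (p * (5 - (star p * p) ^+ 2)).

Lemma hom_quintic (A B : unitalCstar R) (h : A -> B) p :
  unital_star_hom h -> h (quintic p) = quintic (h p).
Proof.
move=> hh; have [_ h1 hM hs] := hh.
have hn n : h n%:R = n%:R.
  by elim: n => [|n ih]; rewrite ?(hom0 hh)// !mulrS (homD hh) h1 ih.
by rewrite /quintic (homZ hh) hM (homB hh) !expr2 !hM hs hn.
Qed.

Lemma star_n (A : unitalCstar R) n : star (n%:R : A) = n%:R.
Proof. by elim: n => [|n ih]; rewrite ?star0// mulrS starD star1 ih. Qed.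

Lemma rnorm_n (A : unitalCstar R) n : rnorm (n%:R : A) <= n%:R.
Proof.
elim: n => [|n ih]; first by rewrite rnorm0.
by rewrite !mulrS (le_trans (rnormD _ _))// lerD// rnorm1_le.
Qed.

Lemma scaleVn (A : unitalCstar R) n (x : A) : (n.+1%:R)^-1%:C *: (n.+1%:R * x) = x.
Proof.
rewrite mulr_natl -[x *+ _]scaler_nat scalerA -(rmorph_nat (real_complex R)).
by rewrite -rmorphM mulVf ?pnatr_eq0// rmorph1 scale1r.
Qed.

(* [p = q k], where [k] is a fixed point of [x |-> (4 + (q* q)^2 x^5) / 5]. *)
Lemma quintic_surj (B : unitalCstar R) (q : B) : rnorm q <= 1 ->
  exists2 p, rnorm p <= 1 & q = quintic p.
Proof.
move=> q1; pose y := star q * q.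
have sy : star y = y by rewrite /y starM starK.
have y1 : rnorm y <= 1 by rewrite /y rnorm_starM expr_le1 ?rnorm_ge0.
have sr (r : R) (x : B) : star x = x -> star (r%:C *: x) = r%:C *: x.
  by move=> sx; rewrite starZ sx /= oppr0.
have [] := @fixed_point _ _ (5^-1%:C *: (4 : B)) (5^-1%:C *: y ^+ 2) 5.
- exact/sr/star_n.
- by apply: sr; rewrite expr2 starM sy.
- by rewrite -!cscalerAr -!cscalerAl mulr_natl mulr_natr.
- rewrite !rnormZr gtr0_norm ?invr_gt0//.
  have : rnorm (y ^+ 2) <= 1.
    by rewrite (le_trans (rnormX _ _))// exprn_ile1 ?rnorm_ge0.
  have := rnorm_n B 4; lra.
move=> k [sk kE k1 kC]; exists (q * k).
  by rewrite (le_trans (rnormM _ _))// mulr_ile1 ?rnorm_ge0.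
have ky : y * k = k * y.
  apply: kC; first by rewrite -cscalerAr -cscalerAl mulr_natl mulr_natr.
  by rewrite -cscalerAr -cscalerAl -exprS -exprSr.
have E : star (q * k) * (q * k) = y * k ^+ 2.
  by rewrite starM sk -mulrA (mulrA (star q)) -/y mulrA -ky -mulrA.
have E2 : (y * k ^+ 2) ^+ 2 = y ^+ 2 * k ^+ 4.
  by rewrite exprMn_comm -?exprM//; exact: commrX.
(* The fixed-point equation gives 5 k - y^2 k^5 = 4, and the quintic at [q * k] is q (5 k - y^2 k^5)
   / 4. *)
have kE5 : 5 * k = 4 + y ^+ 2 * k ^+ 5.
  by rewrite {1}kE -cscalerAl -scalerDr -cscalerAr scaleVn.
have ky2 : k * (y ^+ 2 * k ^+ 4) = y ^+ 2 * k ^+ 5.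
  by rewrite mulrA (commrX 2 (esym ky)) -mulrA -exprS.
rewrite /quintic E E2 -mulrA mulrBr ky2 (commr_nat k) kE5 addrK.
by rewrite (commr_nat q) scaleVn.
Qed.

(* With [a = p* p], [b = a^2] and [x] the value of the quintic at [p], one has
   [(x* x)^2 = b (5 - b)^4 / 256], and
   [b (5 - b)^4 + (b - 1)^2 (256 - 113 b + 18 b^2 - b^3) = 256].  Only [a^2] and
   not [a] enters, so that positivity of [p* p] is not needed. *)
Lemma quintic_bound (A : unitalCstar R) (p : A) : rnorm p <= 11 / 10 ->
  rnorm (quintic p) <= 1.
Proof.
move=> p1; pose a := star p * p.
have sa : star a = a by rewrite /a starM starK.
have a1 : rnorm a <= 121 / 100.
  have -> : 121 / 100 = (11 / 10) ^+ 2 :> R by field.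
  by rewrite rnorm_starM lerXn2r ?nnegrE ?rnorm_ge0// divr_ge0.
pose b := a ^+ 2.
have sX x n : star x = x -> star (x ^+ n) = x ^+ n :> A.
  move=> sx; elim: n => [|n ih]; first by rewrite !expr0 star1.
  by rewrite [in LHS]exprS starM ih sx -exprSr.
have b1 : rnorm b <= 3 / 2.
  apply: (le_trans (rnormX _ _)); apply: (@le_trans _ _ ((121 / 100) ^+ 2)).
    by rewrite lerXn2r ?nnegrE ?rnorm_ge0 ?divr_ge0.
  by rewrite expr2; lra.
have sr (r : R) (x : A) : star x = x -> star (r%:C *: x) = r%:C *: x.
  by move=> sx; rewrite starZ sx /= oppr0.
have sb : star b = b by exact: sX.
(* Here [1 - y] is the cubic factor divided by 256. With |b| <= 3/2 the norm of [y] is at most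
   213.375 / 256, so [1 - y] has a square root [c]. *)
pose y := 256^-1%:C *: (b ^+ 3 - 18 * b ^+ 2 + 113 * b).
have sy : star y = y.
  by apply: sr; rewrite starD starB sX// (starM 18) (starM 113) !star_n sX// sb
    (commr_nat b) (commr_nat (b ^+ 2)).
have y1 : rnorm y <= 1.
  rewrite rnormZr gtr0_norm ?invr_gt0// ler_pdivrMl// mulr1.
  apply: (le_trans (rnormD _ _)); apply: (le_trans (lerD (rnormD _ _) (lexx _))).
  rewrite rnormN; have b0 := rnorm_ge0 b.
  have bX n : rnorm (b ^+ n) <= (3 / 2) ^+ n.
    by rewrite (le_trans (rnormX _ _))// lerXn2r ?nnegrE ?divr_ge0.
  have b3 := bX 3; have b2 : rnorm (18 * b ^+ 2) <= 18 * (3 / 2) ^+ 2.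
    by rewrite (le_trans (rnormM _ _))// ler_pM ?rnorm_ge0 ?rnorm_n.
  have b1' : rnorm (113 * b) <= 113 * (3 / 2).
    by rewrite (le_trans (rnormM _ _))// ler_pM ?rnorm_ge0 ?rnorm_n.
  move: b3 b2 b1'; lra.
have [c [sc cc cC]] := exists_sqrt sy y1.
have one : 256^-1%:C *: (256 : A) = 1 by rewrite -[X in _ *: X]mulr1 scaleVn.
pose e := peval a.
have yE : 1 - y = e (256^-1%:C *: (256 - ('X ^+ 2) ^+ 3 + 18 * ('X ^+ 2) ^+ 2
    - 113 * 'X ^+ 2)).
  rewrite /e pevalZ !pevalB pevalD pevalB (pevalM _ 18) (pevalM _ 113)
    !peval_n !pevalXn pevalX.
  rewrite -/b -addrA -addrA -[_ + (_ - _)]opprK.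
  have -> : - (- b ^+ 3 + (18 * b ^+ 2 - 113 * b)) =
      b ^+ 3 - 18 * b ^+ 2 + 113 * b by rewrite !opprD !opprK addrA.
  by rewrite scalerBr one.
pose d := star (quintic p) * quintic p.
have dE : d = e (16^-1%:C *: ((5 - 'X ^+ 2) * 'X * (5 - 'X ^+ 2))).
  rewrite /e pevalZ (pevalM _ _ (5 - _)) (pevalM _ _ 'X) pevalB peval_n pevalXn pevalX.
  rewrite /d /quintic starZ starM starB star_n (sX a 2)//.
  rewrite -cscalerAl -cscalerAr scalerA !mulrA.
  congr (_ *: _); have -> : conjc (4^-1)%:C = (4^-1)%:C :> R[i] by rewrite /= oppr0.
  by rewrite -rmorphM; congr (_%:C); field.
(* As [1 - y] is a polynomial in [a], the element [a] commutes with [y], and [c] commutes with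
   whatever commutes with [y]. *)
have ca : c * a = a * c.
  apply/esym/cC; have : a * (1 - y) = (1 - y) * a by rewrite yE peval_comm.
  by rewrite mulrBr mulrBl mulr1 mul1r => /addrI/oppr_inj.
have ec q : c * e q = e q * c by exact: peval_comm.
(* The square of [v] is (b - 1)^2 (1 - y), the second summand of the polynomial identity over 256,
   and the square of [d] is the first. *)
pose v := e ('X ^+ 2 - 1) * c.
have dv1 : d * d + v * v = 1.
  rewrite /v dE -[X in _ + X]mulrA [c * _]mulrA ec -[_ * c * c]mulrA cc yE mulrA.
  rewrite -!pevalM -pevalD -!scalerAl -!scalerAr scalerA.
  have -> : (16^-1)%:C * (16^-1)%:C = (256^-1)%:C :> R[i].
    by rewrite -rmorphM; congr (_%:C); field.
  rewrite -scalerDr [X in _ *: X](_ : _ = 256); last by ring.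
  by rewrite pevalZ peval_n one.
have sd : star d = d by rewrite /d starM starK.
have sv : star v = v.
  rewrite /v starM sc -ec; congr (_ * _).
  by rewrite /e pevalB pevalXn pevalX (peval_n _ 1) starB star1 sX.
rewrite -(@ler_pXn2r _ 2) ?nnegrE ?rnorm_ge0// expr1n -rnorm_starM.
apply: (pythagoras sd sv _ dv1).
rewrite /v dE -[RHS]mulrA ec !mulrA; congr (_ * _).
by rewrite -!pevalM; congr e; rewrite mulrC.
Qed.

(** A lift with an arbitrarily small excess would not do later, since the sizes of the new symbols
    are prescribed. The quintic absorbs the excess 1/10 left by the quotient norm being an
    infimum. *)
Lemma quot_lift (A : unitalCstar R) (I : closed_ideal A) (q : quotient_cstar I) :
  exists2 x, quot_pi I x = q & rnorm x <= rnorm q.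
Proof.
have unit_ball (r : quotient_cstar I) : rnorm r <= 1 ->
    exists2 x, quot_pi I x = r & rnorm x <= 1.
  move=> /quintic_surj[p p1 ->].
  have [|x xp x1] := @quot_rnorm_lift _ _ I p (10^-1); first by rewrite invr_gt0.
  exists (quintic x); first by rewrite (hom_quintic _ (quot_pi_hom I)) xp.
  apply: quintic_bound; apply: (le_trans (ltW x1)).
  have -> : 11 / 10 = 1 + 10^-1 :> R by field.
  by rewrite lerD2r.
have [q0|q0] := eqVneq (rnorm q) 0.
  exists 0; last by rewrite rnorm0 q0.
  by rewrite (rnorm0_eq0 q0).
have qp : 0 < rnorm q by rewrite lt_def q0 rnorm_ge0.
have [|x xq x1] := unit_ball ((rnorm q)^-1%:C *: q).
  by rewrite rnormZr gtr0_norm ?invr_gt0// mulVf.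
exists ((rnorm q)%:C *: x).
  rewrite (homZ (quot_pi_hom I)) xq scalerA -rmorphM mulfV// rmorph1.
  exact: scale1r.
by rewrite rnormZr gtr0_norm// ler_piMr// ltW.
Qed.

End Lifting.

(** * The free algebra on a normed set *)

Section FreeAlgebra.
Variables (R : realType) (S : normedSet R).

Inductive term :=
  | Gen of S
  | One
  | Lin of R[i] & term & term
  | Mul of term & term
  | Star of term.

Record rep := Rep {
  rep_alg : unitalCstar R;
  rep_gen : S -> rep_alg;
  rep_contractive : @contractive R S (cstar_nset rep_alg) rep_gen }.

Fixpoint eval (r : rep) (t : term) : rep_alg r :=
  match t with
  | Gen s => rep_gen r s
  | One => 1
  | Lin k t u => k *: eval r t + eval r u
  | Mul t u => eval r t * eval r u
  | Star t => star (eval r t)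
  end.

Fixpoint bound (t : term) : R :=
  match t with
  | Gen s => nsize s
  | One => 1
  | Lin k t u => complex.Re `|k| * bound t + bound u
  | Mul t u => bound t * bound u
  | Star t => bound t
  end.

Lemma Re_norm_ge0 (k : R[i]) : 0 <= complex.Re `|k|.
Proof. by rewrite normc_def /= sqrtr_ge0. Qed.

(** Independence of the bound from the representation keeps the supremum of the seminorms finite. *)
Lemma eval_bound r t : rnorm (eval r t) <= bound t.
Proof.
elim: t => [s||k t ht u hu|t ht u hu|t ht] /=.
- exact: rep_contractive.
- exact: rnorm1_le.
- rewrite (le_trans (rnormD _ _))// rnormZ lerD// ler_wpM2l//.
  exact: Re_norm_ge0.
- by rewrite (le_trans (rnormM _ _))// ler_pM ?rnorm_ge0.
- by rewrite rnorm_star.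
Qed.

Definition cauchy_terms (u : nat -> term) := forall e : R, 0 < e ->
  exists N, forall m n, (N <= m)%N -> (N <= n)%N ->
    forall r, rnorm (eval r (u m) - eval r (u n)) < e.

(** Sequences of terms, rather than families of values over all [r], keep the carrier in the
    universe of the algebras that occur in [rep]: representations are quantified over only in
    propositions. *)
Record cseq := CSeq { cterm :> nat -> term; cseqP : cauchy_terms cterm }.

HB.instance Definition _ := gen_eqMixin cseq.
HB.instance Definition _ := gen_choiceMixin cseq.

Lemma lim_eval_ex r (u : cseq) : exists l, rcvg (fun n => eval r (u n)) l.
Proof.
apply: complete_rnorm => e /(cseqP u)[N h]; exists N => m n Nm Nn; exact: h.
Qed.

Definition lim_eval r (u : cseq) : rep_alg r := projT1 (cid (lim_eval_ex r u)).

Lemma lim_evalP r (u : cseq) : rcvg (fun n => eval r (u n)) (lim_eval r u).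
Proof. exact: projT2 (cid (lim_eval_ex r u)). Qed.

(** The rank [N] comes from the uniform Cauchy condition; the rank [M], which depends on [r], only
    serves to choose the auxiliary index [p]. *)
Lemma lim_eval_near (u : cseq) (e : R) : 0 < e -> exists N, forall n,
  (N <= n)%N -> forall r, rnorm (lim_eval r u - eval r (u n)) <= e.
Proof.
move=> e0; have e2 : 0 < e / 2 by rewrite divr_gt0.
have [N h] := cseqP u e2; exists N => n Nn r.
have [M k] := lim_evalP r u e2; pose p := maxn N M.
rewrite (le_trans (rnorm_tri _ (eval r (u p)) _))// [e]splitr lerD// ltW//.
  by rewrite k// leq_maxr.
by rewrite h// leq_maxl.
Qed.

Definition cseq_rel : rel cseq :=
  fun u v => `[< forall r, lim_eval r u = lim_eval r v >].

Lemma cseq_rel_refl : reflexive cseq_rel.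
Proof. by move=> u; apply/asboolP. Qed.

Lemma cseq_rel_sym : symmetric cseq_rel.
Proof. by move=> u v; apply/asboolP/asboolP => h r. Qed.

Lemma cseq_rel_trans : transitive cseq_rel.
Proof.
by move=> v u w /asboolP uv /asboolP vw; apply/asboolP => r; rewrite uv.
Qed.

Canonical cseq_equiv :=
  EquivRel cseq_rel cseq_rel_refl cseq_rel_sym cseq_rel_trans.

Definition free := {eq_quot cseq_equiv}.
HB.instance Definition _ := Choice.on free.
HB.instance Definition _ := EqQuotient.on free.

Definition free_pi (u : cseq) : free := \pi_free u.
Definition ev r (q : free) : rep_alg r := lim_eval r (repr q).

Lemma ev_pi r u : ev r (free_pi u) = lim_eval r u.
Proof.
have /eqP := reprK (free_pi u).
by rewrite [X in _ == X]/free_pi eqmodE => /asboolP /(_ r).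
Qed.

(** Since representations separate points, every algebraic law of [free] is inherited from the
    algebras [rep_alg r]. *)
Lemma ev_inj q q' : (forall r, ev r q = ev r q') -> q = q'.
Proof.
move=> h; rewrite -(reprK q) -(reprK q'); apply/eqP; rewrite eqmodE.
exact/asboolP.
Qed.

Lemma cauchy_cst t : cauchy_terms (fun=> t).
Proof. by move=> e e0; exists 0%N => *; rewrite subrr rnorm0. Qed.

Lemma cauchy_lin k (u v : cseq) : cauchy_terms (fun n => Lin k (u n) (v n)).
Proof.
move=> e e0; have K0 : 0 < complex.Re `|k| + 1 by rewrite ltr_wpDl ?Re_norm_ge0.
have e1 : 0 < e / (complex.Re `|k| + 1) by rewrite divr_gt0.
have [[N h] [N' h']] := (cseqP u e1, cseqP v e1); exists (maxn N N') => m n.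
rewrite !geq_max => /andP[Nm N'm] /andP[Nn N'n] r /=.
rewrite opprD addrACA -scalerBr (le_lt_trans (rnormD _ _))// rnormZ.
have := h m n Nm Nn r; have := h' m n N'm N'n r; set d := e / _ => h1 h2.
have -> : e = complex.Re `|k| * d + d.
  by rewrite -[X in _ + X]mul1r -mulrDl mulrC divfK// gt_eqF.
by apply: ler_ltD => //; rewrite ler_wpM2l ?Re_norm_ge0// ltW.
Qed.

(** From some rank on, all terms stay within 1 of a single one, to which [eval_bound] applies.
    Products need this uniform bound. *)
Lemma cseq_bounded (u : cseq) : exists K N, 0 <= K /\ forall n, (N <= n)%N ->
  forall r, rnorm (eval r (u n)) <= K.
Proof.
have [N h] := cseqP u ltr01; exists (`|bound (u N)| + 1), N; split=> [|n Nn r].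
  by rewrite addr_ge0.
rewrite -[eval r (u n)](subrK (eval r (u N))) addrC.
rewrite (le_trans (rnormD _ _))// lerD//.
  by rewrite (le_trans (eval_bound _ _))// ler_norm.
exact/ltW/h.
Qed.

Lemma cauchy_mul (u v : cseq) : cauchy_terms (fun n => Mul (u n) (v n)).
Proof.
move=> e e0; have [K [M [K0 hK]]] := cseq_bounded u.
have [K' [M' [K0' hK']]] := cseq_bounded v.
have L0 : 0 < K + K' + 1 by rewrite ltr_wpDl// addr_ge0.
have e1 : 0 < e / (K + K' + 1) by rewrite divr_gt0.
have [[N h] [N' h']] := (cseqP u e1, cseqP v e1).
exists (maxn (maxn M M') (maxn N N')) => m n.
rewrite !geq_max => /andP[/andP[Mm M'm] /andP[Nm N'm]].
move=> /andP[/andP[Mn M'n] /andP[Nn N'n]] r /=.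
have := h m n Nm Nn r; have := h' m n N'm N'n r; set d := e / _ => h1 h2.
set x := eval r (u m) in h2 *; set y := eval r (v m) in h1 *.
set x' := eval r (u n) in h2 *; set y' := eval r (v n) in h1 *.
have -> : x * y - x' * y' = (x - x') * y + x' * (y - y').
  by rewrite mulrBl mulrBr subrKA.
have -> : e = d * K' + K * d + d.
  by rewrite mulrC -mulrDl -[X in _ + X]mul1r -mulrDl mulrC [K' + K]addrC divfK// gt_eqF.
have d0 : 0 < d by [].
rewrite (le_lt_trans (rnormD _ _))// ltr_pwDr// lerD//.
  rewrite (le_trans (rnormM _ _))// ler_pM ?rnorm_ge0//; first exact: ltW.
  exact: hK'.
rewrite (le_trans (rnormM _ _))// ler_pM ?rnorm_ge0//; first exact: hK.
exact: ltW.
Qed.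

Lemma cauchy_star (u : cseq) : cauchy_terms (fun n => Star (u n)).
Proof.
move=> e /(cseqP u)[N h]; exists N => m n Nm Nn r /=.
by rewrite -starB rnorm_star h.
Qed.

Definition free_term t : free := free_pi (CSeq (cauchy_cst t)).
(** No constructor of [term] stands for zero; -1 + 1 represents it. *)
Definition free_zero : free := free_term (Lin (-1) One One).
Definition free_lin k (q q' : free) : free :=
  free_pi (CSeq (cauchy_lin k (repr q) (repr q'))).
Definition free_mul (q q' : free) : free :=
  free_pi (CSeq (cauchy_mul (repr q) (repr q'))).
Definition free_star (q : free) : free := free_pi (CSeq (cauchy_star (repr q))).
Definition free_add := free_lin 1.
Definition free_scale k q := free_lin k q free_zero.
Definition free_opp := free_scale (-1).

Lemma ev_term r t : ev r (free_term t) = eval r t.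
Proof.
rewrite ev_pi; apply: rcvg_unique (lim_evalP _ _) _; exact: rcvg_cst.
Qed.

Lemma ev_lin r k q q' : ev r (free_lin k q q') = k *: ev r q + ev r q'.
Proof.
rewrite ev_pi; apply: rcvg_unique (lim_evalP _ _) _.
by apply: rcvgD; [apply: rcvg_scale|]; exact: lim_evalP.
Qed.

Lemma ev_mul r q q' : ev r (free_mul q q') = ev r q * ev r q'.
Proof.
rewrite ev_pi; apply: rcvg_unique (lim_evalP _ _) _.
by apply: rcvgM; exact: lim_evalP.
Qed.

Lemma ev_star r q : ev r (free_star q) = star (ev r q).
Proof.
rewrite ev_pi; apply: rcvg_unique (lim_evalP _ _) _.
by apply: rcvg_star; exact: lim_evalP.
Qed.

Lemma ev_zero r : ev r free_zero = 0.
Proof. by rewrite ev_term /= scaleN1r addNr. Qed.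

Lemma ev_add r q q' : ev r (free_add q q') = ev r q + ev r q'.
Proof. by rewrite ev_lin scale1r. Qed.

Lemma ev_scale r k q : ev r (free_scale k q) = k *: ev r q.
Proof. by rewrite ev_lin ev_zero addr0. Qed.

Lemma ev_opp r q : ev r (free_opp q) = - ev r q.
Proof. by rewrite ev_scale scaleN1r. Qed.

Lemma ev_one r : ev r (free_term One) = 1.
Proof. exact: ev_term. Qed.

Definition evE := (ev_add, ev_opp, ev_zero, ev_scale, ev_mul, ev_star, ev_one).

Lemma free_addA : associative free_add.
Proof. by move=> *; apply: ev_inj => r; rewrite !evE addrA. Qed.

Lemma free_addC : commutative free_add.
Proof. by move=> *; apply: ev_inj => r; rewrite !evE addrC. Qed.

Lemma free_add0 : left_id free_zero free_add.
Proof. by move=> *; apply: ev_inj => r; rewrite !evE add0r. Qed.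

Lemma free_addN : left_inverse free_zero free_opp free_add.
Proof. by move=> *; apply: ev_inj => r; rewrite !evE addNr. Qed.

HB.instance Definition _ :=
  GRing.isZmodule.Build free free_addA free_addC free_add0 free_addN.

Lemma evD r q q' : ev r (q + q') = ev r q + ev r q'.
Proof. exact: ev_add. Qed.

Lemma evB r q q' : ev r (q - q') = ev r q - ev r q'.
Proof. by rewrite evD; congr (_ + _); exact: ev_opp. Qed.

Lemma free_scaleA k l q : free_scale k (free_scale l q) = free_scale (k * l) q.
Proof. by apply: ev_inj => r; rewrite !evE scalerA. Qed.

Lemma free_scale1 : left_id 1 free_scale.
Proof. by move=> *; apply: ev_inj => r; rewrite !evE scale1r. Qed.

Lemma free_scaleDr : right_distributive free_scale +%R.
Proof. by move=> *; apply: ev_inj => r; rewrite !(evD, evE) scalerDr. Qed.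

Lemma free_scaleDl q : {morph free_scale^~ q : k l / k + l}.
Proof. by move=> *; apply: ev_inj => r; rewrite !(evD, evE) scalerDl. Qed.

HB.instance Definition _ :=
  GRing.Zmodule_isLmodule.Build R[i] free free_scaleA free_scale1
    free_scaleDr free_scaleDl.

Lemma evZ r k q : ev r (k *: q) = k *: ev r q.
Proof. exact: ev_scale. Qed.

(* The supremum of the [rnorm (ev r q)], as the least common upper bound. *)
Definition free_rnorm (q : free) : R :=
  inf [set M : R | 0 <= M /\ forall r, rnorm (ev r q) <= M].

Lemma free_has_inf q :
  has_inf [set M : R | 0 <= M /\ forall r, rnorm (ev r q) <= M].
Proof.
split; last by exists 0 => M [].
have [N h] := @lim_eval_near (repr q) 1 ltr01.
exists (`|bound (repr q N)| + 1); split=> [|r]; first by rewrite addr_ge0.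
rewrite -[ev r q](subrK (eval r (repr q N))) addrC.
rewrite (le_trans (rnormD _ _))// lerD//; last exact: h.
by rewrite (le_trans (eval_bound _ _))// ler_norm.
Qed.

Lemma free_rnorm_le q M : 0 <= M -> (forall r, rnorm (ev r q) <= M) ->
  free_rnorm q <= M.
Proof. by move=> M0 h; apply: ge_inf => //; exists 0 => ? []. Qed.

Lemma ev_rnorm r q : rnorm (ev r q) <= free_rnorm q.
Proof. by apply: lb_le_inf => [|M []//]; have [] := free_has_inf q. Qed.

Lemma free_rnorm_ge0 q : 0 <= free_rnorm q.
Proof. by apply: lb_le_inf => [|M []//]; have [] := free_has_inf q. Qed.

Definition free_norm q : R[i] := (free_rnorm q)%:C.

Lemma free_normD q q' : free_norm (q + q') <= free_norm q + free_norm q'.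
Proof.
rewrite -rmorphD lecR free_rnorm_le ?addr_ge0 ?free_rnorm_ge0// => r.
by rewrite evD (le_trans (rnormD _ _))// lerD// ev_rnorm.
Qed.

Lemma free_rnormZ_le k q :
  free_rnorm (k *: q) <= complex.Re `|k| * free_rnorm q.
Proof.
rewrite free_rnorm_le ?mulr_ge0 ?Re_norm_ge0 ?free_rnorm_ge0// => r.
by rewrite evZ rnormZ ler_wpM2l ?Re_norm_ge0 ?ev_rnorm.
Qed.

Lemma free_normZ k q : free_norm (k *: q) = `|k| * free_norm q.
Proof.
rewrite Re_norm_real -rmorphM; congr (_%:C).
apply/eqP; rewrite eq_le free_rnormZ_le andTb.
have [->|k0] := eqVneq k 0.
  by rewrite normr0 [complex.Re 0]/= mul0r free_rnorm_ge0.
have -> : complex.Re `|k| * free_rnorm q =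
    complex.Re `|k| * free_rnorm (k^-1 *: (k *: q)).
  by rewrite scalerA mulVf// scale1r.
apply: (le_trans (ler_wpM2l (Re_norm_ge0 _) (free_rnormZ_le _ _))).
rewrite mulrA -{1}[k]invrK.
have -> : complex.Re `|k^-1^-1| * complex.Re `|k^-1| = 1.
  have := normrM k^-1^-1 k^-1; rewrite mulVf ?invr_eq0// normr1.
  rewrite [`|k^-1^-1|]Re_norm_real [`|k^-1|]Re_norm_real -rmorphM => /esym.
  exact: (@fmorph_inj _ _ (real_complex R) _ 1).
by rewrite mul1r.
Qed.

Lemma free_norm0_eq0 q : free_norm q = 0 -> q = 0.
Proof.
move=> /(@fmorph_inj _ _ (real_complex R) _ 0) q0; apply: ev_inj => r.
rewrite [RHS]ev_zero; apply: rnorm0_eq0; apply/eqP.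
by rewrite eq_le rnorm_ge0 andbT -q0 ev_rnorm.
Qed.

HB.instance Definition _ :=
  Lmodule_isNormed.Build R[i] free free_normD free_normZ free_norm0_eq0.

Lemma free_ballP q q' (e : R[i]) : 0 < e ->
  ball q e q' <-> free_rnorm (q - q') < complex.Re e.
Proof.
case: e => a b; rewrite ltcE /= => /andP[/eqP b0 a0].
by rewrite -ball_normE /ball_ /= ltcE /= b0 eqxx.
Qed.

Lemma free_rnorm_tri q q' q'' :
  free_rnorm (q - q'') <= free_rnorm (q - q') + free_rnorm (q' - q'').
Proof. by rewrite -lecR rmorphD -(subrKA q' q) free_normD. Qed.

Lemma free_rnormBC q q' : free_rnorm (q - q') = free_rnorm (q' - q).
Proof.
have h p p' : free_rnorm (p - p') <= free_rnorm (p' - p).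
  rewrite free_rnorm_le ?free_rnorm_ge0// => r.
  by rewrite evB rnormBC -evB ev_rnorm.
by apply/eqP; rewrite eq_le !h.
Qed.

Lemma free_term_dense q (e : R) : 0 < e ->
  exists t, free_rnorm (q - free_term t) <= e.
Proof.
move=> e0; have [N h] := lim_eval_near (repr q) e0; exists (repr q N).
by rewrite free_rnorm_le ?(ltW e0)// => r; rewrite evB ev_term h.
Qed.

(** A diagonal argument: centres of balls of radius 2^-n in the filter are replaced by terms at
    distance at most 2^-n, and these terms form a Cauchy sequence whose class is the limit. *)
Lemma free_complete (F : set_system free) :
  ProperFilter F -> cauchy F -> cvg F.
Proof.
move=> FF cF; pose d n : R := 2^-1 ^+ n.
have d0 n : 0 < d n by rewrite exprn_gt0// invr_gt0.
have dC n : 0 < (d n)%:C by rewrite ltcR.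
have small e : 0 < e -> exists N, forall n, (N <= n)%N -> d n < e.
  by apply: expr_small; apply/andP; split; lra.
have Fp n : exists q, F (ball q (d n)%:C).
  by move/cauchyP : cF => /(_ _ (dC n)).
have [p hp] := choice Fp.
have [t ht] := choice (fun n => free_term_dense (p n) (d0 n)).
have pp m n : free_rnorm (p m - p n) < d m + d n.
  have [q [q1 q2]] := filter_ex (filterI (hp m) (hp n)).
  move: q1 q2 => /(free_ballP _ _ (dC _)) /= q1 /(free_ballP _ _ (dC _)) /= q2.
  by rewrite (le_lt_trans (free_rnorm_tri _ q _))// ltrD// free_rnormBC.
have ct : cauchy_terms t.
  (* The path from [t m] through [p m] and [p n] to [t n] is shorter than 2 (d m + d n), whence the
     quarter of [e]. *)
  move=> e e0; have e4 : 0 < e / 4 by rewrite divr_gt0.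
  have [N hN] := small _ e4; exists N => m n /hN dm /hN dn r.
  rewrite -!ev_term -evB (le_lt_trans (ev_rnorm _ _))//.
  rewrite (le_lt_trans (free_rnorm_tri _ (p m) _))//.
  rewrite (le_lt_trans (lerD (lexx _) (free_rnorm_tri _ (p n) _)))//.
  rewrite [X in X + _]free_rnormBC.
  by have := ht m; have := ht n; have := pp m n; lra.
pose l := free_pi (CSeq ct).
apply/cvg_ex; exists l; apply/cvg_ballP => e e0.
have re0 : 0 < complex.Re e by move: e0; rewrite ltcE => /andP[].
have e4 : 0 < complex.Re e / 4 by rewrite divr_gt0.
have [N1 h1] := small _ e4; have [N2 h2] := lim_eval_near (CSeq ct) e4.
pose n := maxn N1 N2.
have ln : free_rnorm (l - free_term (t n)) <= complex.Re e / 4.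
  rewrite free_rnorm_le ?(ltW e4)// => r.
  by rewrite evB ev_term ev_pi h2// leq_maxr.
apply: filterS (hp n) => q /(free_ballP _ _ (dC _)) /= qn.
apply/free_ballP => //.
rewrite (le_lt_trans (free_rnorm_tri _ (free_term (t n)) _))//.
rewrite (le_lt_trans (lerD (lexx _) (free_rnorm_tri _ (p n) _)))//.
rewrite [X in _ + (X + _)]free_rnormBC.
by have := ht n; have := h1 n (leq_maxl _ _); move: ln qn; lra.
Qed.

HB.instance Definition _ := Uniform_isComplete.Build free free_complete.

Lemma free_mulA : associative free_mul.
Proof. by move=> *; apply: ev_inj => r; rewrite !evE mulrA. Qed.

Lemma free_mul1l : left_id (free_term One) free_mul.
Proof. by move=> *; apply: ev_inj => r; rewrite !evE mul1r. Qed.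

Lemma free_mul1r : right_id (free_term One) free_mul.
Proof. by move=> *; apply: ev_inj => r; rewrite !evE mulr1. Qed.

Lemma free_mulDl : left_distributive free_mul +%R.
Proof. by move=> *; apply: ev_inj => r; rewrite !(evD, evE) mulrDl. Qed.

Lemma free_mulDr : right_distributive free_mul +%R.
Proof. by move=> *; apply: ev_inj => r; rewrite !(evD, evE) mulrDr. Qed.

Lemma free_scaleAl (k : R[i]) (q q' : free) :
  k *: free_mul q q' = free_mul (k *: q) q'.
Proof. by apply: ev_inj => r; rewrite !(evZ, evE) cscalerAl. Qed.

Lemma free_scaleAr (k : R[i]) (q q' : free) :
  k *: free_mul q q' = free_mul q (k *: q').
Proof. by apply: ev_inj => r; rewrite !(evZ, evE) cscalerAr. Qed.

Lemma free_starK : involutive free_star.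
Proof. by move=> *; apply: ev_inj => r; rewrite !evE starK. Qed.

Lemma free_starD : {morph free_star : q q' / q + q'}.
Proof. by move=> *; apply: ev_inj => r; rewrite !(evD, evE) starD. Qed.

Lemma free_starZ (k : R[i]) q : free_star (k *: q) = conjc k *: free_star q.
Proof. by apply: ev_inj => r; rewrite !(evZ, evE) starZ. Qed.

Lemma free_starM q q' :
  free_star (free_mul q q') = free_mul (free_star q') (free_star q).
Proof. by apply: ev_inj => r; rewrite !evE starM. Qed.

Lemma free_normM (q q' : free) : `|free_mul q q'| <= `|q| * `|q'|.
Proof.
rewrite -[leRHS]/((free_rnorm q)%:C * (free_rnorm q')%:C) -rmorphM lecR.
rewrite free_rnorm_le ?mulr_ge0 ?free_rnorm_ge0// => r.
by rewrite ev_mul (le_trans (rnormM _ _))// ler_pM ?rnorm_ge0 ?ev_rnorm.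
Qed.

Lemma free_norm_starM (q : free) : `|free_mul (free_star q) q| = `|q| ^+ 2.
Proof.
rewrite -[RHS]/((free_rnorm q)%:C ^+ 2) -rmorphXn; congr (_%:C).
apply/eqP; rewrite eq_le; apply/andP; split.
  rewrite free_rnorm_le ?exprn_ge0 ?free_rnorm_ge0// => r.
  rewrite ev_mul ev_star rnorm_starM.
  by rewrite lerXn2r ?nnegrE ?rnorm_ge0 ?free_rnorm_ge0 ?ev_rnorm.
(* By the C*-identity in each representation, the square root of [M] is a common upper bound of the
   [rnorm (ev r q)]. *)
set M := free_rnorm (free_mul _ _); have M0 : 0 <= M by exact: free_rnorm_ge0.
rewrite -[M]sqr_sqrtr// lerXn2r ?nnegrE ?sqrtr_ge0 ?free_rnorm_ge0//.
rewrite free_rnorm_le ?sqrtr_ge0// => r.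
rewrite -(@ler_pXn2r _ 2) ?nnegrE ?rnorm_ge0 ?sqrtr_ge0// sqr_sqrtr//.
by rewrite -rnorm_starM -ev_star -ev_mul ev_rnorm.
Qed.

Definition free_algebra : unitalCstar R :=
  @UnitalCstar R free free_mul (free_term One) free_star free_mulA free_mul1l
    free_mul1r free_mulDl free_mulDr free_scaleAl free_scaleAr free_starK
    free_starD free_starZ free_starM free_normM free_norm_starM.

(** * The universal property *)

Lemma ev_hom r : unital_star_hom (ev r : free_algebra -> rep_alg r).
Proof.
split=> [k q q'||q q'|q].
- by rewrite evD evZ.
- exact: ev_one.
- exact: ev_mul.
- exact: ev_star.
Qed.

Lemma hom_term (r : rep) (h : free_algebra -> rep_alg r) :
  unital_star_hom h -> (forall s, h (free_term (Gen s)) = rep_gen r s) ->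
  forall t, h (free_term t) = eval r t.
Proof.
move=> [hl h1 hM hs] hg; elim=> [s||k t ht u hu|t ht u hu|t ht] /=.
- exact: hg.
- exact: h1.
- rewrite -ht -hu -hl; congr h; apply: ev_inj => r'.
  by rewrite evD evZ !ev_term.
- rewrite -ht -hu -hM; congr h; apply: ev_inj => r'.
  by rewrite [RHS]ev_mul !ev_term.
- rewrite -ht -hs; congr h; apply: ev_inj => r'.
  by rewrite [RHS]ev_star !ev_term.
Qed.

Lemma free_gen_le : @contractive R S (cstar_nset free_algebra)
  (fun s => free_term (Gen s)).
Proof.
move=> s; apply: free_rnorm_le => [|r]; first exact: nsize_ge0.
by rewrite ev_term; exact: rep_contractive.
Qed.

(** The map [phi] is itself one of the representations defining the norm, so evaluation at it is the
    extension. For uniqueness, extensions agree on terms, which are dense, and homomorphisms are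
    contractive. *)
Lemma free_algebra_universal (B : unitalCstar R) (phi : S -> B) :
  @contractive R S (cstar_nset B) phi ->
  exists! h : free_algebra -> B,
    unital_star_hom h /\ forall s, h (free_term (Gen s)) = phi s.
Proof.
move=> cphi; pose r := Rep cphi; exists (ev r); split.
  by split=> [|s]; [exact: (ev_hom r)|exact: (ev_term r)].
move=> h [hh hg]; apply/funext => q; apply/eqP; rewrite -subr_eq0.
apply/eqP/rnorm0_eq0/eqP; rewrite eq_le rnorm_ge0 andbT.
apply: (@small_le0 _ _ 2) => // e e0; have [t qt] := free_term_dense q e0.
apply: (le_trans (rnorm_tri _ (eval r t) _)); rewrite mulr_natl mulr2n lerD//.
  by rewrite -ev_term -evB (le_trans (ev_rnorm _ _)).
rewrite -(@hom_term r h hh hg) -(homB hh) (le_trans (hom_contractive hh _))//.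
by rewrite /rnorm /= free_rnormBC in qt *.
Qed.

Definition scaled_free : scaledFree S :=
  ScaledFree free_gen_le free_algebra_universal.

End FreeAlgebra.

(** * Presentations and Tietze transformations *)

Section Isomorphisms.
Variable R : realType.
Implicit Types A B C : unitalCstar R.

Lemma hom_id A : unital_star_hom (id : A -> A).
Proof. by []. Qed.

Lemma hom_comp A B C (g : B -> C) (h : A -> B) :
  unital_star_hom g -> unital_star_hom h -> unital_star_hom (g \o h).
Proof.
move=> [gl g1 gM gs] [hl h1 hM hs]; split=> [k x y||x y|x] /=.
- by rewrite hl gl.
- by rewrite h1 g1.
- by rewrite hM gM.
- by rewrite hs gs.
Qed.

Lemma hom_cancel A B (h : A -> B) (g : B -> A) :
  unital_star_hom h -> cancel h g -> cancel g h -> unital_star_hom g.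
Proof.
move=> [hl h1 hM hs] hK gK; have hI := can_inj hK.
by split=> [k x y||x y|x]; apply: hI; rewrite ?hl ?h1 ?hM ?hs !gK.
Qed.

Lemma isomorphic_sym A B : cstar_isomorphic A B -> cstar_isomorphic B A.
Proof.
move=> [h [hh [g hK gK]]]; exists g; split; first exact: hom_cancel hK gK.
by exists h.
Qed.

Lemma isomorphic_trans A B C :
  cstar_isomorphic A B -> cstar_isomorphic B C -> cstar_isomorphic A C.
Proof.
move=> [h [hh bh]] [g [hg bg]]; exists (g \o h).
by split; [exact: hom_comp|exact: bij_comp].
Qed.

Lemma quot_pi_eq0 A (I : closed_ideal A) x :
  quot_pi I x = 0 :> quotient_cstar I <-> ideal_set I x.
Proof. by rewrite -[0]/(quot_pi I 0) quot_piP subr0. Qed.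

(** The equivalence says that [I] is the kernel of the map from [A] to the quotient by [J]: one
    direction makes the induced map well defined, the other makes it injective. *)
Lemma quotient_isomorphic A B (h : A -> B) (I : closed_ideal A)
    (J : closed_ideal B) :
  unital_star_hom h -> (forall y, exists x, h x = y) ->
  (forall x, ideal_set I x <-> ideal_set J (h x)) ->
  cstar_isomorphic (quotient_cstar I) (quotient_cstar J).
Proof.
move=> hh hsurj IJ.
pose f (q : quotient_cstar I) : quotient_cstar J := quot_pi J (h (repr q)).
have fE x : f (quot_pi I x) = quot_pi J (h x).
  by apply/quot_piP; rewrite -(homB hh); apply/IJ/quot_repr.
have [_ h1 hM hs] := hh; have [_ pM _ _] := quot_pi_hom J.
exists f; split.
  split=> [k q r||q r|q].
  - have [x ->] := quot_surj q; have [y ->] := quot_surj r.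
    by rewrite -quot_piZ -quot_piD !fE (homD hh) (homZ hh) quot_piD quot_piZ.
  - by rewrite -[LHS]/(f (quot_pi I 1)) fE h1.
  - have [x ->] := quot_surj q; have [y ->] := quot_surj r.
    by rewrite -[LHS]/(f (quot_mul _ _)) quot_mulE !fE hM -quot_mulE.
  - have [x ->] := quot_surj q.
    by rewrite -[LHS]/(f (quot_star _)) quot_starE !fE hs -quot_starE.
have fsurj q : exists r, f r = q.
  have [y ->] := quot_surj q; have [x <-] := hsurj y.
  by exists (quot_pi I x); rewrite fE.
have finj : injective f.
  move=> q r; have [x ->] := quot_surj q; have [y ->] := quot_surj r.
  by rewrite !fE => /quot_piP; rewrite -(homB hh) => /IJ/quot_piP.
have [g gK] := choice fsurj; exists g => // q.
by apply: finj; rewrite gK.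
Qed.

End Isomorphisms.

(** * Presented algebras under Tietze transformations *)

Section Presentations.
Variable R : realType.
Implicit Types (P : presentation R) (S T U : normedSet R).

(** Contractivity of homomorphisms makes the restriction to the generators contractive, so
    [free_universal] applies to it. *)
Lemma free_hom_unique S (F : scaledFree S) (B : unitalCstar R) (h h' : F -> B) :
  unital_star_hom h -> unital_star_hom h' ->
  (forall s, h (free_gen F s) = h' (free_gen F s)) -> h =1 h'.
Proof.
move=> hh hh' E.
have [|f [_ fU]] := @free_universal _ _ F B (fun s => h (free_gen F s)).
  move=> s; apply: le_trans (free_gen_contractive F s).
  exact: hom_contractive.
move=> x; rewrite -(fU h (conj hh (fun=> erefl))).
by rewrite -(fU h' (conj hh' (fun s => esym (E s)))).
Qed.

Lemma disjoint_union_case S T U (i : S -> U) (j : T -> U) (B : unitalCstar R)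
    (f : S -> B) (g : T -> B) : is_disjoint_union i j ->
  @contractive R S (cstar_nset B) f -> @contractive R T (cstar_nset B) g ->
  exists phi : U -> B, [/\ @contractive R U (cstar_nset B) phi,
    forall s, phi (i s) = f s & forall t, phi (j t) = g t].
Proof.
move=> [[e eK Ke] ni nj] cf cg.
exists (fun u => match e u with inl s => f s | inr t => g t end); split.
- move=> u; rewrite -{2}(Ke u); case: (e u) => [s|t].
    by rewrite ni; exact: cf.
  by rewrite nj; exact: cg.
- by move=> s; rewrite (eK (inl s)).
- by move=> t; rewrite (eK (inr t)).
Qed.

Lemma norm_le_rnorm (A : unitalCstar R) (x : A) (r : R) :
  (`|x| <= r%:C) = (rnorm x <= r).
Proof. by rewrite rnormE lecR. Qed.

(* Sending each new symbol [t] to [g t] is a retraction of free algebras which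
   identifies both quotients. *)
Lemma add_generators_retract P P' T (g : T -> free_cstar P)
    (rho : generators P -> generators P') (sym : T -> generators P')
    (rho_hat : free_cstar P -> free_cstar P') :
  (forall t, rnorm (g t) <= nsize t) -> is_disjoint_union rho sym ->
  unital_star_hom rho_hat ->
  (forall s, rho_hat (free_gen (free_cstar P) s) =
    free_gen (free_cstar P') (rho s)) ->
  relations P' = (rho_hat @` relations P) `|`
    [set free_gen (free_cstar P') (sym t) - rho_hat (g t) | t in [set: T]] ->
  exists k : free_cstar P' -> free_cstar P, [/\ unital_star_hom k,
    cancel rho_hat k,
    forall t, k (free_gen (free_cstar P') (sym t)) = g t &
    forall x, ideal_set (gen_ideal (relations P')) x <->
      ideal_set (gen_ideal (relations P)) (k x)].
Proof.
move=> gT dU hr rE relE.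
have [phi [cphi phi_rho phi_sym]] :=
  disjoint_union_case dU (@free_gen_contractive _ _ (free_cstar P)) gT.
have [k [[hk kE] _]] := free_universal (free_cstar P') cphi.
have krho : cancel rho_hat k.
  apply: (free_hom_unique (hom_comp hk hr) (hom_id _)) => s /=.
  by rewrite rE kE phi_rho.
exists k; split=> // [t|x]; first by rewrite kE phi_sym.
split=> [|Jkx].
  apply: gen_ideal_sub => // y; rewrite relE => -[[z Pz <-]|[t _ <-]].
    by rewrite krho; exact: sub_gen_ideal.
  by rewrite (homB hk) krho kE phi_sym subrr; exact: ideal0.
set J := gen_ideal _.
have J_rho y : ideal_set (gen_ideal (relations P)) y -> ideal_set J (rho_hat y).
  apply: gen_ideal_sub => // z Pz; apply: sub_gen_ideal; rewrite relE; left.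
  by exists z.
(* Both sides are homomorphisms in [x] and agree on generators, since on a new symbol the difference
   is a defining relation. Hence [x] lies in [J] as soon as [rho_hat (k x)] does. *)
suff : quot_pi J x = quot_pi J (rho_hat (k x)).
  by move=> /quot_piP/idealD-/(_ _ (J_rho _ Jkx)); rewrite subrK.
have hpi := quot_pi_hom J.
apply: (free_hom_unique hpi (hom_comp hpi (hom_comp hr hk))) => u /=.
have [[e eK Ke] _ _] := dU; rewrite -(Ke u); case: (e u) => [s|t].
  by rewrite kE phi_rho rE.
rewrite kE phi_sym; apply/quot_piP; apply: sub_gen_ideal; rewrite relE; right.
by exists t.
Qed.

Lemma add_generators_isomorphic P P' :
  add_generators P P' -> cstar_isomorphic (presented P') (presented P).
Proof.
move=> [T [g [rho [sym [rho_hat [gT dU hr rE relE]]]]]].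
have {}gT t : rnorm (g t) <= nsize t by rewrite -norm_le_rnorm.
have [k [hk krho _ Jk]] := add_generators_retract gT dU hr rE relE.
by apply: (quotient_isomorphic hk) => // y; exists (rho_hat y).
Qed.

Lemma add_relations_isomorphic P P' :
  add_relations P P' -> cstar_isomorphic (presented P) (presented P').
Proof.
move=> [Q [QJ ->]]; apply: (quotient_isomorphic (hom_id _)) => [y|x].
  by exists y.
split; apply: (gen_ideal_sub (hom_id _)) => y.
  by move=> Py; apply: sub_gen_ideal; left.
by move=> [Py|/QJ//]; exact: sub_gen_ideal.
Qed.

Lemma tietze_isomorphic P P' :
  tietze P P' -> cstar_isomorphic (presented P) (presented P').
Proof.
case=> [/add_relations_isomorphic|/add_relations_isomorphic/isomorphic_sym|
  /add_generators_isomorphic/isomorphic_sym|/add_generators_isomorphic] //.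
Qed.

(** Each [t] is attached to a lift of the preimage under [h] of the value of [psi] at [sym t]. Then
    [psi] is the composite of the retraction [k], the quotient map and the injective [h], which
    gives its kernel. The inclusions are arbitrary so that both presentations can be enlarged to the
    same [F]. *)
Lemma add_generators_kernel P T U (F : scaledFree U) (rho : generators P -> U)
    (sym : T -> U) (B : unitalCstar R) (h : presented P -> B) (psi : F -> B) :
  is_disjoint_union rho sym -> unital_star_hom h -> bijective h ->
  unital_star_hom psi ->
  (forall s, psi (free_gen F (rho s)) =
    h (quot_pi _ (free_gen (free_cstar P) s))) ->
  exists X : set F, add_generators P (Presentation X) /\
    forall x, ideal_set (gen_ideal X) x <-> psi x = 0.
Proof.
move=> dU hh [h' hK h'K] hpsi psiE; have hh' := hom_cancel hh hK h'K.
have [_ nrho nsym] := dU.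
have lift t : exists2 x : free_cstar P,
    h (quot_pi _ x) = psi (free_gen F (sym t)) & rnorm x <= nsize t.
  have [x xE xn] := quot_lift (h' (psi (free_gen F (sym t))) : presented P).
  exists x; first by rewrite xE h'K.
  (* As [h'] and [psi] are contractive and the lift loses nothing, the size of [t] bounds the lift,
     as a new symbol requires. *)
  rewrite (le_trans xn)// (le_trans (hom_contractive hh' _))//.
  rewrite (le_trans (hom_contractive hpsi _))// -nsym.
  exact: free_gen_contractive.
have [g gE gT] : exists2 g : T -> free_cstar P,
    forall t, h (quot_pi _ (g t)) = psi (free_gen F (sym t)) &
    forall t, rnorm (g t) <= nsize t.
  have {}lift t : exists x : free_cstar P,
      h (quot_pi _ x) = psi (free_gen F (sym t)) /\ rnorm x <= nsize t.
    by have [x] := lift t; exists x.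
  by have [g hg] := choice lift; exists g => t; have [] := hg t.
have [|r [[hr rE] _]] := @free_universal _ _ (free_cstar P) F
    (fun s => free_gen F (rho s)).
  by move=> s; rewrite -nrho; exact: free_gen_contractive.
pose X : set F := (r @` relations P) `|`
  [set free_gen F (sym t) - r (g t) | t in [set: T]].
exists X; split.
  exists T, g, rho, sym, r; split=> // t.
  by rewrite norm_le_rnorm.
have [k [hk kr kE Jk]] :=
  @add_generators_retract P (Presentation X) T g rho sym r gT dU hr rE erefl.
have hpi := quot_pi_hom (gen_ideal (relations P)).
have psi_k : psi =1 h \o (quot_pi _ \o k).
  apply: free_hom_unique => // [|u]; first exact/hom_comp/hom_comp.
  have [[e eK Ke] _ _] := dU; rewrite -(Ke u); case: (e u) => [s|t] /=.
    by rewrite psiE -rE kr.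
  by rewrite (kE t) gE.
move=> x; rewrite psi_k /=; split=> [/Jk/quot_pi_eq0 ->|]; first exact: hom0.
by rewrite -(hom0 hh) => /(can_inj hK)/quot_pi_eq0/Jk.
Qed.

Lemma sum_size_ge0 S T (u : S + T) :
  0 <= match u with inl s => nsize s | inr t => nsize t end.
Proof. by case: u => ?; exact: nsize_ge0. Qed.

Definition sum_nset S T : normedSet R := NormedSet (@sum_size_ge0 S T).

Lemma sum_nset_union S T :
  @is_disjoint_union R S T (sum_nset S T) inl inr.
Proof. by split=> //; exists id => -[]. Qed.

(** Exchanging the roles of the summands lets the second presentation be enlarged to the same
    generators as the first. *)
Lemma sum_nset_unionC S T :
  @is_disjoint_union R T S (sum_nset S T) inr inl.
Proof.
split=> //; exists (fun u => match u with inl s => inr s | inr t => inl t end);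
  by case.
Qed.

End Presentations.

Theorem theorem3p3 (R : realType) (P1 P2 : presentation R) :
  cstar_isomorphic (presented P1) (presented P2) <->
  exists Q1 Q2 Q3 : presentation R,
    tietze P1 Q1 /\ tietze Q1 Q2 /\ tietze Q2 Q3 /\ tietze Q3 P2.
Proof.
split; last first.
  move=> [Q1 [Q2 [Q3 [/tietze_isomorphic i1 [/tietze_isomorphic i2]]]]].
  move=> [/tietze_isomorphic i3 /tietze_isomorphic i4].
  exact: isomorphic_trans i1 (isomorphic_trans i2 (isomorphic_trans i3 i4)).
move=> [h [hh bh]].
pose U := sum_nset (generators P1) (generators P2); pose F := scaled_free U.
have pi_le P : @contractive R (generators P) (cstar_nset (presented P))
    (fun s => quot_pi _ (free_gen (free_cstar P) s)).
  move=> s; apply: le_trans (hom_contractive (quot_pi_hom _) _) _.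
  exact: free_gen_contractive.
have h_le : @contractive R (generators P1) (cstar_nset (presented P2))
    (fun s => h (quot_pi _ (free_gen (free_cstar P1) s))).
  by move=> s; apply: le_trans (hom_contractive hh _) (pi_le _ s).
have [phi [cphi phi1 phi2]] :=
  disjoint_union_case (sum_nset_union _ _) h_le (pi_le P2).
have [psi [[hpsi psiE] _]] := free_universal F cphi.
have [|X1 [P1X1 kerX1]] :=
  add_generators_kernel (sum_nset_union _ _) hh bh hpsi.
  by move=> s; rewrite psiE phi1.
(* On this side the isomorphism is the identity, as [psi] restricts to the quotient map on the
   second generators. *)
have [||X2 [P2X2 kerX2]] := @add_generators_kernel R P2 _ _ F _ _ _ id psi
  (sum_nset_unionC _ _) (hom_id _) _ hpsi.
- by exists id.
- by move=> s; rewrite psiE phi2.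
(* Both [X1] and [X2] generate the kernel of [psi], so each is redundant for the other: add
   generators, add [X2], remove [X1], remove generators. *)
exists (Presentation X1), (Presentation (X1 `|` X2)), (Presentation X2).
split; first exact: Or43.
split; first by apply: Or41; exists X2; split=> // x /sub_gen_ideal/kerX2/kerX1.
split; last exact: Or44.
apply: Or42; exists X1; split; first by move=> x /sub_gen_ideal/kerX1/kerX2.
by rewrite setUC.
Qed.
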